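(* Let $P$ be an $\omega$-hypergraph satisfying the non-emptiness, acyclicity, relevance and segment axioms. Then the graded set $\mathrm{MaxWF}(P)$ of maximal-well-formed fgs's of $P$ (with its source, target, identity and composition operations) is a strict $\omega$-category, and the function $X\mapsto \max(\cup X)$ induces an isomorphism of $\omega$-categories between $\mathrm{Cell}(P)$ and $\mathrm{MaxWF}(P)$.
   Context: An $\omega$-hypergraph is a set $P$ with a partition $P=\bigsqcup_{n\in\mathbb{N}}P_n$ together with, for $n\in\mathbb{N}$ and $u\in P_{n+1}$, two finite subsets $u^-,u^+\subseteq P_n$. For $U\subseteq P$ and $\epsilon\in\{-,+\}$, $U^\epsilon=\bigcup_{u\in U}u^\epsilon$; also $U^\mp=U^-\setminus U^+$ and $U^\pm=U^+\setminus U^-$. A subset $U\subseteq P_n$ is fork-free if either $n=0$ and $|U|=1$, or $n>0$ and $u^\epsilon\cap v^\epsilon=\emptyset$ for all distinct $u,v\in U$ and all $\epsilon\in\{-,+\}$. For $U\subseteq P_n$, $\triangleleft_U$ is the transitive closure of the relation on $U$ relating $u$ to $v$ when $n\ge 1$ and $u^+\cap v^-\neq\emptyset$; a subset $V\subseteq U$ is a segment for $\triangleleft_U$ if $u_1,u_3\in V$ and $u_1\triangleleft_U u_2\triangleleft_U u_3$ imply $u_2\in V$. An $n$-pre-cell of $P$ is a tuple $X=(X_{0,-},X_{0,+},\ldots,X_{n-1,-},X_{n-1,+},X_n)$ of finite subsets $X_{i,\epsilon}\subseteq P_i$, $X_n\subseteq P_n$; one writes $X_{n,-}=X_{n,+}=X_n$.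 For $i<n$, $\partial^\epsilon_i X=(X_{0,-},X_{0,+},\ldots,X_{i-1,-},X_{i-1,+},X_{i,\epsilon})$. A finite set $M\subseteq P_{i+1}$ moves a finite $U\subseteq P_i$ to a finite $V\subseteq P_i$ if $U=(V\cup M^-)\setminus M^+$ and $V=(U\cup M^+)\setminus M^-$. An $n$-cell is an $n$-pre-cell such that $X_{i+1,\epsilon}$ moves $X_{i,-}$ to $X_{i,+}$ for $0\le i<n$, $\epsilon\in\{-,+\}$, and every $X_{i,\epsilon}$ ($0\le i\le n$) is fork-free. $\mathrm{Cell}(P)$ is the graded set of cells. Operations on cells: for an $n$-cell $X$, $\mathrm{id}^{n+1}(X)=(X_{0,-},X_{0,+},\ldots,X_{n-1,-},X_{n-1,+},X_n,X_n,\emptyset)$. For $i<n$ and $n$-cells $X,Y$ with $\partial^+_iX=\partial^-_iY$, $X\ast_iY$ is the $n$-pre-cell $Z$ with $Z_{j,\epsilon}=X_{j,\epsilon}$ for $j<i$, $Z_{i,-}=X_{i,-}$, $Z_{i,+}=Y_{i,+}$, and $Z_{j,\epsilon}=X_{j,\epsilon}\cup Y_{j,\epsilon}$ for $j>i$. Under the axioms below, $\mathrm{Cell}(P)$ is a strict $\omega$-category with these operations. For $u\in P_n$, the atom $\langle u\rangle$ is the $n$-pre-cell with $\langle u\rangle_{n,-}=\langle u\rangle_{n,+}=\{u\}$ and, for $j<n$, $\langle u\rangle_{j,-}=(\langle u\rangle_{j+1,-})^\mp$, $\langle u\rangle_{j,+}=(\langle u\rangle_{j+1,+})^\pm$. Axioms: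 (non-emptiness) $u^-\ne\emptyset$ and $u^+\neq\emptyset$ for all $u\in P_n$, $n\ge1$; (acyclicity) $\triangleleft_{P_n}$ is irreflexive for all $n\geq 1$; (relevance) $\langle u\rangle$ is a cell for all $u\in P$; (segment) for all $k\in\mathbb N$, $u\in P_k$, $n<k$, every $n$-cell $X$ and $\epsilon\in\{-,+\}$, if $\langle u\rangle_{n,\epsilon}\subseteq X_n$ then $\langle u\rangle_{n,\epsilon}$ is a segment for $\triangleleft_{X_n}$. Fgs's: $R\subseteq P\times P$ is the smallest reflexive transitive relation with $x\,R\,y$ whenever $y\in x^-\cup x^+$; for $X\subseteq P$, $R(X)=\{y\mid \exists x\in X,\ x\,R\,y\}$. A finite graded subset of dimension $n$ ($n$-fgs) is a tuple $X=(X_0,\ldots,X_n)$ of finite subsets $X_k\subseteq P_k$; it is often identified with $\bigcup_kX_k$ (but $n$ is part of the data). For an $n$-fgs $X$, $\max(X)$ is the $n$-fgs of those $x\in X$ such that no $y\in X$ with $y\ne x$ satisfies $y\,R\,x$; $X$ is maximal if $\max(X)=X$. For an $n$-pre-cell $X$, $\cup X$ is the $n$-fgs $\bigcup_{i\le n}(X_{i,-}\cup X_{i,+})$. For $n\ge1$ and a maximal $n$-fgs $X$, $\partial^{\max,-}_{n-1}(X)$ (resp. $\partial^{\max,+}_{n-1}(X)$) is the $(n-1)$-fgs $Y$ with $Y_{n-1}=X_{n-1}\cup X_n^\mp$ (resp. $X_{n-1}\cup X_n^\pm$) and $Y_i=X_i$ for $i\le n-2$. A maximal $n$-fgs $X$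 is maximal-well-formed if: $X_n$ is fork-free; when $n\geq1$, $\partial^{\max,-}_{n-1}(X)$ and $\partial^{\max,+}_{n-1}(X)$ are maximal-well-formed; and, when $n\ge2$, $\partial^{\max,\epsilon}_{n-2}\partial^{\max,-}_{n-1}(X)=\partial^{\max,\epsilon}_{n-2}\partial^{\max,+}_{n-1}(X)$ for $\epsilon\in\{-,+\}$. $\mathrm{MaxWF}(P)$ is the graded set of maximal-well-formed fgs's, with source and target $\partial^{\max,\pm}$, identities $\mathrm{id}^{n+1}(X)=(X_0,\ldots,X_n,\emptyset)$ and, for $i<n$ and $n$-dimensional $X,Y$ with equal $i$-target of $X$ and $i$-source of $Y$, composition $\max(R(X)\cup R(Y))$. *)

(* Defs.v *)
From mathcomp Require Import all_boot.
From mathcomp Require Import boolp classical_sets cardinality.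
From Stdlib Require Import Relation_Operators.

Set Implicit Arguments.
Unset Strict Implicit.
Unset Printing Implicit Defensive.

Local Open Scope classical_set_scope.

(** Throughout, signs are booleans: [false] is "-" and [true] is "+". *)

Record globData := GlobData {
  gcell :> nat -> Type;
  bd : bool -> forall n, gcell n.+1 -> gcell n }.

Arguments bd {g} e {n} u.

Fixpoint bd_iter (G : globData) (e : bool) (i k : nat) : G (k + i) -> G i :=
  match k return G (k + i) -> G i with
  | 0 => id
  | k'.+1 => fun u => @bd_iter G e i k' (bd e u)
  end.

(** [bd_to e h u] is the iterated boundary of [u] in dimension [i <= n]; the
    cast is along [n = (n - i) + i]. *)
Definition bd_to (G : globData) (e : bool) (n i : nat) (h : i <= n) (u : G n) :
    G i :=
  @bd_iter G e i (n - i) (ecast m (G m) (esym (subnK h)) u).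

Definition composable (G : globData) (n i : nat) (h : i < n) (u v : G n) :
    Prop :=
  bd_to true (ltnW h) u = bd_to false (ltnW h) v.

(** A graded set with sources, targets, identities, and an [i]-composition
    defined exactly on the [i]-composable pairs. *)
Record omegaData := OmegaData {
  glob :> globData;
  idc : forall n, glob n -> glob n.+1;
  compc : forall n i (h : i < n) (u v : glob n),
    composable h u v -> glob n }.

Arguments idc {o n} u.
Arguments compc {o n i h u v} c.

Fixpoint id_iter (C : omegaData) (i k : nat) (u : C i) : C (k + i) :=
  match k return C (k + i) with
  | 0 => u
  | k'.+1 => idc (id_iter k' u)
  end.

Definition id_to (C : omegaData) (n i : nat) (h : i <= n) (u : C i) : C n :=
  ecast m (C m) (subnK h) (id_iter (n - i) u).

(** In each axiom the composites on the right-hand side are asserted to be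
    defined, whence the existential quantifiers over composability proofs. *)
Record strict_omega_cat (C : omegaData) : Prop := StrictOmegaCat {
  bd_globular : forall n e (u : C n.+2), bd e (bd false u) = bd e (bd true u);
  bd_id : forall n e (u : C n), bd e (idc u) = u;
  bd_comp_top : forall n (h : n < n.+1) (u v : C n.+1) (c : composable h u v),
    bd false (compc c) = bd false u /\ bd true (compc c) = bd true v;
  bd_comp_low : forall n i (h : i < n) (h' : i < n.+1) e (u v : C n.+1)
      (c : composable h' u v),
    exists c' : composable h (bd e u) (bd e v), bd e (compc c) = compc c';
  comp_idl : forall n i (h : i < n) (u : C n),
    exists c : composable h (id_to (ltnW h) (bd_to false (ltnW h) u)) u,
      compc c = u;
  comp_idr : forall n i (h : i < n) (u : C n),
    exists c : composable h u (id_to (ltnW h) (bd_to true (ltnW h) u)),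
      compc c = u;
  compA : forall n i (h : i < n) (u v w : C n)
      (c1 : composable h u v) (c2 : composable h v w),
    exists (c3 : composable h (compc c1) w) (c4 : composable h u (compc c2)),
      compc c3 = compc c4;
  id_comp : forall n i (h : i < n) (h' : i < n.+1) (u v : C n)
      (c : composable h u v),
    exists c' : composable h' (idc u) (idc v), idc (compc c) = compc c';
  exchange : forall n i j (hi : i < n) (hj : j < n) (u u' v v' : C n)
      (ci : composable hi u u') (ci' : composable hi v v')
      (cj : composable hj u v) (cj' : composable hj u' v'), i < j ->
    exists (dj : composable hj (compc ci) (compc ci'))
           (di : composable hi (compc cj) (compc cj')),
      compc dj = compc di }.

Record omega_functor (C D : omegaData) (F : forall n, C n -> D n) : Prop :=
  OmegaFunctor {
  functor_bd : forall n e (u : C n.+1), F n (bd e u) = bd e (F n.+1 u);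
  functor_id : forall n (u : C n), F n.+1 (idc u) = idc (F n u);
  functor_comp : forall n i (h : i < n) (u v : C n) (c : composable h u v),
    exists c' : composable h (F n u) (F n v), F n (compc c) = compc c' }.

Definition omega_iso (C D : omegaData) (F : forall n, C n -> D n) : Prop :=
  omega_functor F /\
  exists G : forall n, D n -> C n,
    omega_functor G /\ forall n, cancel (F n) (G n) /\ cancel (G n) (F n).

(** The cells of dimension [n] will be the elements of a fixed type that
    satisfy a predicate [D n]; [totalOps] gives the operations by formulas that
    make sense on the whole type.  [obd e n] goes from dimension [n.+1] to
    dimension [n]. *)
Record totalOps := TotalOps {
  car : Type;
  obd : bool -> nat -> car -> car;
  oid : nat -> car -> car;
  ocomp : nat -> nat -> car -> car -> car }.

Definition bd_closed (O : totalOps) (D : nat -> car O -> Prop) : Prop :=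
  forall e n X, D n.+1 X -> D n (obd e n X).

Definition sub_glob (O : totalOps) (D : nat -> car O -> Prop)
    (hb : bd_closed D) : globData :=
  @GlobData (fun n => {X : car O | D n X})
    (fun e n u => exist (D n) (obd e n (sval u)) (hb e n _ (svalP u))).

Record closed_ops (O : totalOps) (D : nat -> car O -> Prop) : Prop := ClosedOps {
  closed_bd : bd_closed D;
  closed_id : forall n X, D n X -> D n.+1 (oid n X);
  closed_comp : forall n i (h : i < n) (u v : sub_glob closed_bd n),
    composable h u v -> D n (ocomp n i (sval u) (sval v)) }.

Arguments closed_ops : clear implicits.

Definition sub_omega (O : totalOps) (D : nat -> car O -> Prop)
    (hD : closed_ops O D) : omegaData :=
  @OmegaData (sub_glob (closed_bd hD))
    (fun n u => exist (D n.+1) (oid n (sval u)) (closed_id hD (svalP u)))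
    (fun n i h u v c =>
       exist (D n) (ocomp n i (sval u) (sval v)) (closed_comp c)).

(** The partition of [P] is given by [dim].  [face e u] is the set [u^e]; by
    [face_dim] it is empty when [dim u = 0], where the hypergraph has no
    structure. *)
Record omegaHypergraph := OmegaHypergraph {
  hcar :> Type;
  dim : hcar -> nat;
  face : bool -> hcar -> set hcar;
  face_finite : forall e u, finite_set (face e u);
  face_dim : forall e u v, face e u v -> dim u = (dim v).+1 }.

Definition layer (P : omegaHypergraph) (n : nat) : set P := [set x | dim x = n].

Definition faces (P : omegaHypergraph) (e : bool) (U : set P) : set P :=
  \bigcup_(u in U) face e u.

Arguments layer : clear implicits.

(** [U^\mp] for the sign "-", [U^\pm] for the sign "+". *)
Definition border (P : omegaHypergraph) (e : bool) (U : set P) : set P :=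
  faces e U `\` faces (~~ e) U.

Definition fork_free (P : omegaHypergraph) (n : nat) (U : set P) : Prop :=
  if n is 0 then exists x, U = [set x]
  else forall u v e, U u -> U v -> u <> v -> face e u `&` face e v = set0.

(** For [U] in dimension [0] the relation is empty, since so are the faces. *)
Definition tri (P : omegaHypergraph) (U : set P) : P -> P -> Prop :=
  clos_trans P (fun u v => [/\ U u, U v & face true u `&` face false v !=set0]).

Definition segment (P : omegaHypergraph) (U V : set P) : Prop :=
  forall u1 u2 u3, V u1 -> V u3 -> tri U u1 u2 -> tri U u2 u3 -> V u2.

(** The tuple [(X_{0,-}, X_{0,+}, ..., X_{n-1,-}, X_{n-1,+}, X_n)] is encoded
    by the family [X i e] extended by [X n - = X n + = X_n] and by the empty
    set above dimension [n]; [is_precell] imposes this normal form, so that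
    equality of families is equality of tuples. *)
Definition faceFamily (P : omegaHypergraph) := nat -> bool -> set P.

Definition is_precell (P : omegaHypergraph) (n : nat) (X : faceFamily P) : Prop :=
  [/\ forall i e, finite_set (X i e),
      forall i e, X i e `<=` layer P i,
      X n false = X n true
    & forall i e, n < i -> X i e = set0].

Definition moves (P : omegaHypergraph) (M U V : set P) : Prop :=
  U = (V `|` faces false M) `\` faces true M /\
  V = (U `|` faces true M) `\` faces false M.

Definition is_cell (P : omegaHypergraph) (n : nat) (X : faceFamily P) : Prop :=
  [/\ is_precell n X,
      forall i e, i < n -> moves (X i.+1 e) (X i false) (X i true)
    & forall i e, i <= n -> fork_free i (X i e)].

Definition cell_bd (P : omegaHypergraph) (e : bool) (n : nat) (X : faceFamily P) :
    faceFamily P :=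
  fun i s => if i < n then X i s else if i == n then X n e else set0.

Definition cell_comp (P : omegaHypergraph) (n i : nat) (X Y : faceFamily P) :
    faceFamily P :=
  fun j e => if j < i then X j e
             else if j == i then (if e then Y i true else X i false)
             else X j e `|` Y j e.

(** The identity [(..., X_n, X_n, set0)] has the same encoding as [X]. *)
Definition cell_ops (P : omegaHypergraph) : totalOps :=
  @TotalOps (faceFamily P) (@cell_bd P) (fun _ X => X) (@cell_comp P).

(** [atom_below e u k] is the component of the atom of [u] in codimension
    [k]. *)
Fixpoint atom_below (P : omegaHypergraph) (e : bool) (u : P) (k : nat) : set P :=
  if k is k'.+1 then border e (atom_below e u k') else [set u].

Definition atom (P : omegaHypergraph) (u : P) : faceFamily P :=
  fun j e => if j <= dim u then atom_below e u (dim u - j) else set0.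

Definition non_emptiness (P : omegaHypergraph) : Prop :=
  forall (u : P) e, 0 < dim u -> face e u !=set0.

Definition acyclicity (P : omegaHypergraph) : Prop :=
  forall n, 0 < n -> forall u : P, ~ tri (layer P n) u u.

Definition relevance (P : omegaHypergraph) : Prop :=
  forall u : P, is_cell (dim u) (atom u).

Definition segment_axiom (P : omegaHypergraph) : Prop :=
  forall (u : P) n, n < dim u -> forall (X : faceFamily P) e, is_cell n X ->
    atom u n e `<=` X n e -> segment (X n e) (atom u n e).

Definition Rel (P : omegaHypergraph) : P -> P -> Prop :=
  clos_refl_trans P (fun x y => (face false x `|` face true x) y).

Definition Rclosure (P : omegaHypergraph) (X : set P) : set P :=
  [set y | exists2 x, X x & Rel x y].

Definition max_part (P : omegaHypergraph) (X : set P) : set P :=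
  [set x | X x /\ forall y, X y -> Rel y x -> y = x].

(** An [n]-fgs is identified with the union of its components; [n] is carried
    separately and [X `&` layer P k] is the component [X_k]. *)
Definition is_fgs (P : omegaHypergraph) (n : nat) (X : set P) : Prop :=
  finite_set X /\ forall x, X x -> dim x <= n.

Definition max_bd (P : omegaHypergraph) (e : bool) (n : nat) (X : set P) :
    set P :=
  (X `&` [set x | dim x <= n]) `|` border e (X `&` layer P n.+1).

Fixpoint is_maxwf (P : omegaHypergraph) (n : nat) (X : set P) : Prop :=
  [/\ is_fgs n X,
      max_part X = X,
      fork_free n (X `&` layer P n)
    & match n with
      | 0 => True
      | m.+1 =>
        (forall e, is_maxwf m (max_bd e m X)) /\
        match m with
        | 0 => True
        | l.+1 => forall e, max_bd e l (max_bd false m X) =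
                            max_bd e l (max_bd true m X)
        end
      end].

(** The identity [(X_0, ..., X_n, set0)] has the same union as [X]. *)
Definition maxwf_ops (P : omegaHypergraph) : totalOps :=
  @TotalOps (set P) (@max_bd P) (fun _ X => X)
    (fun _ _ X Y => max_part (Rclosure X `|` Rclosure Y)).

Definition cell_union (P : omegaHypergraph) (n : nat) (X : faceFamily P) : set P :=
  [set x | exists i e, i <= n /\ X i e x].

(** The underlying graded sets are the cells, resp. the maximal-well-formed
    fgs's; closure under the operations is an argument. *)
Definition Cell (P : omegaHypergraph)
    (hC : closed_ops (cell_ops P) (@is_cell P)) : omegaData :=
  sub_omega hC.

Definition MaxWF (P : omegaHypergraph)
    (hM : closed_ops (maxwf_ops P) (@is_maxwf P)) : omegaData :=
  sub_omega hM.

(* Main.v *)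
Require Import Defs.
From mathcomp Require Import all_boot.
From mathcomp Require Import boolp classical_sets cardinality finmap.
From Stdlib Require Import Relation_Operators.

(** The key fact is a gluing theorem: if a finite fork-free set G of
    (n+1)-generators has its non-produced sources in the top of an n-cell X,
    then replacing these sources by the targets of G gives again an n-cell, so
    that G becomes the top of an (n+1)-cell.  It is proved by induction on n;
    acyclicity reduces it to a single generator x, and the segment axiom allows
    the source of x to be isolated in X as one step of a composite in dimension
    n-1, which is then replaced by the target of x.  Composites of cells are
    obtained by gluing.

    Gluing also shows that every generator below a generator of X lies in the
    top of a cell that agrees with X in lower dimensions.  Therefore an element
    of dimension k is maximal in the union of X exactly when it belongs to both
    X_{k,-} and X_{k,+}.  This description of the map to maximal-well-formed
    sets makes it compatible with boundaries and composition, and injective and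
    surjective by induction on the dimension; the axioms of an omega-category
    are then transported along it. *)

Set Implicit Arguments.
Unset Strict Implicit.
Unset Printing Implicit Defensive.

Local Open Scope classical_set_scope.

(** * Induction on finite sets and minimal elements *)

Lemma finite_set_ind (T : Type) (Q : set T -> Prop) :
  (forall A, finite_set A ->
     (forall B, B `<=` A -> B <> A -> Q B) -> Q A) ->
  forall A, finite_set A -> Q A.
Proof.
move=> IH A finA.
have [k] := ubnP #|` fset_set (A : set {classic T})|.
elim: k => // k IHk in A finA *; rewrite ltnS => leAk.
apply: (IH A finA) => B sBA neBA.
have finB : finite_set B by exact: sub_finite_set finA.
apply: (IHk B finB); apply: leq_trans leAk; apply: fproper_ltn_card.
rewrite fproperEneq; apply/andP; split; last by rewrite -(@fset_set_sub {classic T}).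
apply/eqP => eqAB; apply: neBA.
by rewrite -(@fset_setK {classic T} _ finB) eqAB fset_setK.
Qed.

Lemma finite_set_has_minimal (T : Type) (t : T -> T -> Prop) :
  (forall x y z, t x y -> t y z -> t x z) -> (forall x, ~ t x x) ->
  forall A : set T, finite_set A -> A !=set0 ->
  exists2 x, A x & forall y, A y -> ~ t y x.
Proof.
move=> t_tr t_irr; apply: finite_set_ind => A finA IH [a Aa].
have [[b [Ab tba]]|noB] := pselect (exists b, A b /\ t b a); last first.
  by exists a => // y Ay tya; apply: noB; exists y.
have [|/= eqA||m [Am tma] minm] := IH [set x | A x /\ t x a].
- by move=> x [].
- by have: A a by []; rewrite -eqA => -[_ /t_irr].
- by exists b.
by exists m => // y Ay tym; apply: (minm y) => //; split=> //; apply: t_tr tma.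
Qed.

(** * Faces and forks *)

Section Faces.
Context (P : omegaHypergraph).
Implicit Types (U V M : set P) (X : faceFamily P).

Lemma facesU e U V : faces e (U `|` V) = faces e U `|` faces e V.
Proof. exact: bigcup_setU. Qed.

Lemma faces1 e (x : P) : faces e [set x] = face e x.
Proof. exact: bigcup_set1. Qed.

Lemma faces_finite e U : finite_set U -> finite_set (faces e U).
Proof. by move=> finU; apply: bigcup_finite => // u _; apply: face_finite. Qed.

Lemma faces_layer e U n : U `<=` layer P n.+1 -> faces e U `<=` layer P n.
Proof.
move=> sU z [u /sU uU /face_dim]; rewrite /layer /= in uU *.
by rewrite uU => -[].
Qed.

Lemma fork_freeP n U : fork_free n.+1 U <->
  forall e u v z, U u -> U v -> face e u z -> face e v z -> u = v.
Proof.
split=> [ffU e u v z Uu Uv uz vz|ffU u v e Uu Uv neuv].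
  have [//|neuv] := pselect (u = v).
  by have: (face e u `&` face e v) z by []; rewrite (ffU u v e).
by apply/seteqP; split=> // z [uz vz]; apply: neuv; apply: ffU uz vz.
Qed.

Lemma fork_free_subset n U V : U `<=` V -> fork_free n.+1 V -> fork_free n.+1 U.
Proof.
move=> sUV /fork_freeP ffV; apply/fork_freeP => e u v z /sUV Vu /sUV Vv.
exact: ffV.
Qed.

Lemma movesP M U V : moves M U V <-> forall z,
  (U z <-> (V z \/ faces false M z) /\ ~ faces true M z) /\
  (V z <-> (U z \/ faces true M z) /\ ~ faces false M z).
Proof.
rewrite /moves; split=> [[eqU eqV] z|eqUV].
  by split; [rewrite {1}eqU|rewrite {1}eqV].
by split; apply/seteqP; split=> z; have [U_ V_] := eqUV z; move=> /=; tauto.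
Qed.

Hypothesis P_acyclic : acyclicity P.

(** A common element of [u^-] and [u^+] would put [u] below itself for [tri]. *)
Lemma face_disjoint (u z : P) : face true u z -> ~ face false u z.
Proof.
move=> uz uz'; apply: (P_acyclic (n := dim u) _ (u := u)).
  by rewrite (face_dim uz).
by apply: t_step; split=> //; exists z.
Qed.

Lemma exists_initial n U : finite_set U -> U `<=` layer P n.+1 -> U !=set0 ->
  exists2 u, U u & forall v z, U v -> face true v z -> ~ face false u z.
Proof.
move=> finU sU U0.
have [|u|u Uu minu] := finite_set_has_minimal (t := tri (layer P n.+1)) _ _ finU U0.
- by move=> x y z; apply: t_trans.
- exact: P_acyclic.
exists u => // v z Uv vz uz; apply: (minu v) => //; apply: t_step.
by split; [exact: sU|exact: sU|exists z].
Qed.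

Lemma exists_final n U : finite_set U -> U `<=` layer P n.+1 -> U !=set0 ->
  exists2 u, U u & forall v z, U v -> face false v z -> ~ face true u z.
Proof.
move=> finU sU U0.
have [|u|u Uu minu] := finite_set_has_minimal
  (t := fun x y => tri (layer P n.+1) y x) _ _ finU U0.
- by move=> x y z xy yz; apply: t_trans xy.
- exact: P_acyclic.
exists u => // v z Uv vz uz; apply: (minu v) => //; apply: t_step.
by split; [exact: sU|exact: sU|exists z].
Qed.

End Faces.

(** * Gluing *)

Section Gluing.
Context (P : omegaHypergraph).
Implicit Types (G H : set P) (X : faceFamily P).

(** The last clause says that every source that [G] does not produce itself is available in the top
    of [X]. *)
Definition glueable n X G : Prop :=
  [/\ finite_set G, G `<=` layer P n.+1, fork_free n.+1 G
    & border false G `<=` X n false].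

Definition act n X G : faceFamily P := fun i e =>
  if i == n then (X n e `|` faces true G) `\` faces false G else X i e.

Definition glue n X G : faceFamily P := fun i e =>
  if i == n.+1 then G else if e then act n X G i true else X i false.

(** The second conclusion makes the movement reversible: it allows the top of [X] to be recovered
    from that of [act n X G]. *)
Definition gluing_at n : Prop := forall X G, is_cell n X -> glueable n X G ->
  is_cell n (act n X G) /\ forall z, X n false z -> ~ faces true G z.

(** Together with fork-freeness of [G] and of [H], this gives fork-freeness of the union; it also
    excludes a common generator that has a face. *)
Definition separated G H : Prop :=
  forall e u v z, G u -> H v -> face e u z -> ~ face e v z.

Lemma actE n X G z :
  act n X G n false z = ((X n false z \/ faces true G z) /\ ~ faces false G z).
Proof. by rewrite /act eqxx. Qed.

Lemma act_ne n X G i e : i != n -> act n X G i e = X i e.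
Proof. by rewrite /act => /negbTE->. Qed.

Lemma cell_topE n X e : is_cell n X -> X n e = X n false.
Proof. by case: e => // -[[]]. Qed.

Lemma cell_above n X i e : is_cell n X -> n < i -> X i e = set0.
Proof. by case=> -[_ _ _ X0] _ _; apply: X0. Qed.

Lemma cell_bd_cell n X i e : is_cell n X -> i <= n -> is_cell i (cell_bd e i X).
Proof.
case=> -[finX sX topX X0] mvX ffX lein; split.
- split.
  + by move=> j s; rewrite /cell_bd; case: ltnP => // _; case: eqP.
  + by move=> j s z; rewrite /cell_bd; case: ltnP => [_|_]; [|case: eqP => // ->]; apply: sX.
  + by rewrite /cell_bd ltnn eqxx.
  + move=> j s ltij; rewrite /cell_bd ltnNge ltnW //=.
    by rewrite eq_sym (ltn_eqF ltij).
- move=> j s ltji; rewrite /cell_bd ltji.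
  have [ltj1|] := ltnP j.+1 i; first by apply: mvX; apply: leq_trans lein.
  move=> leij; have eqi : i = j.+1 by apply/eqP; rewrite eqn_leq ltji leij.
  by rewrite eqi eqxx; apply: mvX; rewrite -eqi.
- move=> j s leji; rewrite /cell_bd; case: ltnP => [ltji|leij].
    by apply: ffX; apply: leq_trans lein.
  have -> : j = i by apply/eqP; rewrite eqn_leq leji.
  by rewrite eqxx; apply: ffX.
Qed.

Lemma precell_act n X G : is_cell n X -> glueable n X G -> is_precell n (act n X G).
Proof.
case=> -[finX sX topX X0] _ _ [finG sG _ _]; split.
- move=> i e; rewrite /act; case: eqP => // _; apply: finite_setD.
  by rewrite finite_setU; split=> //; apply: faces_finite.
- move=> i e; rewrite /act; case: eqP => // ->; apply: subset_trans (@subDsetl _ _ _) _.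
  by rewrite subUset; split; [exact: sX|exact: faces_layer].
- by rewrite /act eqxx topX.
- by move=> i e ltni; rewrite act_ne ?X0 // gtn_eqF.
Qed.

Lemma act0 n X : act n X set0 = X.
Proof.
apply/funext => i; apply/funext => e; rewrite /act /faces !bigcup_set0.
by rewrite setU0 setD0; case: eqP => // ->.
Qed.

Lemma glue_cell n X G : gluing_at n -> is_cell n X -> glueable n X G ->
  is_cell n.+1 (glue n X G).
Proof.
move=> glue_n cX gG; have [cA disj] := glue_n _ _ cX gG.
have [[finX sX topX X0] mvX ffX] := cX.
have [[finA sA topA A0] mvA ffA] := cA.
have [finG sG ffG bG] := gG.
split; first split.
- by move=> i e; rewrite /glue; case: eqP => // _; case: e.
- by move=> i e; rewrite /glue; case: eqP => [->|_] //; case: e.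
- by rewrite /glue eqxx.
- move=> i e lti; rewrite /glue gtn_eqF //.
  by case: e; [apply: A0|apply: X0]; apply: ltnW.
- move=> i e; rewrite ltnS leq_eqVlt => /orP[/eqP->|ltin].
    (* The movement in dimension [n]: the target equation is the definition of [act]; the source
       equation needs both [bG] and [disj]. *)
    rewrite /glue eqxx ltn_eqF //; apply/movesP => z.
    rewrite (cell_topE true cA) actE.
    have := bG z; rewrite /border /=; have := disj z.
    have [] := pselect (faces false G z); have [] := pselect (faces true G z); tauto.
  rewrite /glue eqSS !(ltn_eqF ltin) (ltn_eqF (leqW ltin)).
  have := mvA i e ltin; have := mvX i e ltin.
  by rewrite !(@act_ne n X G i) ?ltn_eqF //; case: e.
- move=> i e; rewrite leq_eqVlt => /orP[/eqP->|]; first by rewrite /glue eqxx.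
  rewrite ltnS => lein; rewrite /glue ltn_eqF ?ltnS //.
  by case: e; [apply: ffA|apply: ffX].
Qed.

(** With [precell_eq_glue], this shows that every cell of positive dimension arises by gluing its
    top onto its source. *)
Lemma glueable_cell n X : is_cell n.+1 X ->
  glueable n (cell_bd false n X) (X n.+1 false) /\
  act n (cell_bd false n X) (X n.+1 false) = cell_bd true n X.
Proof.
case=> -[finX sX topX X0] mvX ffX.
have /movesP mv := mvX n false (ltnSn n).
split; first split=> //.
- exact: ffX.
- move=> z [fz tz]; rewrite /cell_bd ltnn eqxx; have [] := mv z; tauto.
apply/funext => i; apply/funext => e; rewrite /act /cell_bd !ltnn eqxx.
case: eqP => // ->.
by rewrite ltnn; have [_ ->] := mvX n false (ltnSn n).
Qed.

Lemma precell_eq_glue n X : is_precell n.+1 X ->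
  act n (cell_bd false n X) (X n.+1 false) = cell_bd true n X ->
  X = glue n (cell_bd false n X) (X n.+1 false).
Proof.
move=> [_ _ topX X0] eqA; apply/funext => i; apply/funext => e.
rewrite /glue eqA /cell_bd; have [->|nei] := eqVneq i n.+1; first by case: e.
have [lti|] := ltnP i n; first by case: e.
rewrite leq_eqVlt eq_sym => /orP[/eqP eqin|ltni].
  by rewrite eqin eqxx; case: e.
rewrite gtn_eqF //; transitivity (set0 : set P); last by case: e.
by apply: X0; rewrite ltn_neqAle eq_sym nei.
Qed.

Lemma cell_of_glue n X : gluing_at n -> is_precell n.+1 X ->
  is_cell n (cell_bd false n X) ->
  glueable n (cell_bd false n X) (X n.+1 false) ->
  act n (cell_bd false n X) (X n.+1 false) = cell_bd true n X ->
  is_cell n.+1 X.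
Proof.
move=> glue_n pX cX gX eqX; rewrite (precell_eq_glue pX eqX).
exact: glue_cell.
Qed.

(** Since [I] is closed under predecessors in [G], nothing it consumes is produced by the rest of
    [G], so it can be performed first. *)
Lemma glueable_initial n X G I : glueable n X G -> I `<=` G ->
  (forall g i z, G g -> I i -> face true g z -> face false i z -> I g) ->
  [/\ glueable n X I, glueable n (act n X I) (G `\` I)
    & act n (act n X I) (G `\` I) = act n X G].
Proof.
move=> [finG sG ffG bG] sIG initI.
have eqG : G = I `|` (G `\` I).
  by apply/seteqP; split=> z /=; [case: (pselect (I z)); tauto|move=> [/sIG|[]]].
have faces_eq e z : faces e G z <-> faces e I z \/ faces e (G `\` I) z.
  by rewrite {1}eqG facesU.
have sep z : faces true (G `\` I) z -> ~ faces false I z.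
  by move=> [g [Gg nIg] gz] [i Ii iz]; apply: nIg; apply: initI gz iz.
split.
- split.
  + exact: sub_finite_set finG.
  + exact: subset_trans sG.
  + exact: fork_free_subset ffG.
  + move=> z [Iz nIz]; apply: bG; split; first by apply/faces_eq; left.
    by move=> /faces_eq[//|/sep].
- split.
  + exact: finite_setD.
  + by move=> z [/sG].
  + by apply: fork_free_subset ffG => z [].
  + move=> z [Jz nJz]; rewrite actE; split.
      have [|nIz] := pselect (faces true I z); first by right.
      by left; apply: bG; split=> /=; rewrite faces_eq; tauto.
    (* Fork-freeness of [G]: a source of the remaining part has not been consumed by [I]. *)
    move=> [i Ii iz]; move: Jz => [g [Gg nIg] gz]; apply: nIg.
    by have /fork_freeP/(_ false g i z) -> := ffG => //; apply: sIG.
- apply/funext => j; apply/funext => e; rewrite /act eqxx; case: eqP => // _.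
  apply/seteqP; split=> z /=; rewrite !faces_eq; have := sep z; tauto.
Qed.

Hypothesis P_acyclic : acyclicity P.

Lemma glueable_minimal n X G g : glueable n X G -> G g ->
  (forall v z, G v -> face true v z -> ~ face false g z) ->
  [/\ glueable n X [set g], glueable n (act n X [set g]) (G `\ g)
    & act n (act n X [set g]) (G `\ g) = act n X G].
Proof.
move=> gG Gg ming; apply: glueable_initial => // [z ->//|h i z Gh -> hz gz].
by case: (ming h z Gh hz).
Qed.

Lemma glueableU n X G H : glueable n X G -> glueable n (act n X G) H ->
  separated G H -> glueable n X (G `|` H).
Proof.
move=> [finG sG /fork_freeP ffG bG] [finH sH /fork_freeP ffH bH] sep; split.
- by rewrite finite_setU.
- by rewrite subUset.
- apply/fork_freeP => e u v z [Gu|Hu] [Gv|Hv] uz vz.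
  + exact: ffG uz vz.
  + by case: (sep e u v z).
  + by case: (sep e v u z).
  + exact: ffH uz vz.
- move=> z; rewrite /border !facesU /=.
  have := bG z; have := bH z; rewrite actE /border /=; tauto.
Qed.

(** The two sides could differ only on a source of [G] recreated by [H]. By separation [G] does not
    produce such an element, so it would lie in [X], against the disjointness obtained by gluing the
    union of [G] and [H]. *)
Lemma actU n X G H : gluing_at n -> is_cell n X -> glueable n X G ->
  glueable n (act n X G) H -> separated G H ->
  act n (act n X G) H = act n X (G `|` H).
Proof.
move=> glue_n cX gG gH sep.
have [_ disj] := glue_n _ _ cX (glueableU gG gH sep).
have [_ _ _ bG] := gG.
have noHG z : faces true H z -> ~ faces false G z.
  move=> Hz Gz; apply: (disj z); last by rewrite facesU; right.
  apply: bG; split=> // -[g Gg gz]; case: Hz => h Hh hz.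
  exact: sep Gg Hh gz hz.
apply/funext => j; apply/funext => e; rewrite /act eqxx; case: eqP => // _.
by apply/seteqP; split=> z /=; rewrite !facesU /=; have := noHG z; tauto.
Qed.

(** A minimal generator of [G] is performed first; the rest is then glueable on the new cell, and
    induction applies. *)
Lemma gluing_at_of_single n :
  (forall X x, is_cell n X -> dim x = n.+1 -> face false x `<=` X n false ->
     is_cell n (act n X [set x]) /\ forall z, X n false z -> ~ face true x z) ->
  gluing_at n.
Proof.
move=> single X G cX gG; have [finG _ _ _] := gG.
elim/finite_set_ind: G / finG => G finG IH in X cX gG *.
have [_ sG ffG bG] := gG.
have [G0|/set0P G0] := eqVneq G set0.
  by rewrite G0 act0; split=> // z _ [].
have [g Gg ming] := exists_initial P_acyclic finG sG G0.
have [gg gG' <-] := glueable_minimal gG Gg ming.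
have [_ _ _ bg] := gg.
have sg : face false g `<=` X n false.
  move=> z gz; apply: bg; split; rewrite faces1 //.
  by move=> /(face_disjoint P_acyclic).
have [cX' disj] := single X g cX (sG g Gg) sg.
have [||cA disj'] := IH (G `\ g) _ _ _ cX' gG'.
- by move=> z [].
- by move=> eqG; have := Gg; rewrite -{1}eqG => -[_]; apply.
split=> // z Xz [h Gh hz].
(* For [h] other than [g], minimality of [g] says that [g] does not consume the target [z] of [h],
   so [z] is still in the new top and contradicts the induction hypothesis. *)
have [ehg|nehg] := pselect (h = g); first by apply: (disj z); rewrite -?ehg.
apply: (disj' z); last by exists h.
by rewrite actE !faces1; split; [left|apply: (ming h)].
Qed.

(* The separation claim is proved by a double induction: a clash of targets
   is excluded by first performing a minimal element of G, a clash of sources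
   by delaying a maximal element of H. *)
Lemma glueable_separated n X G H : gluing_at n -> is_cell n X ->
  glueable n X G -> glueable n (act n X G) H -> separated G H.
Proof.
move=> glue_n cX gG gH; have [finG _ _ _] := gG; have [finH _ _ _] := gH.
move: H finH X cX gG gH; elim/finite_set_ind: G / finG => G finG IHG H finH X cX gG gH.
elim/finite_set_ind: H / finH => H finH IHH in gH *.
have [_ sG ffG bG] := gG; have [_ sH ffH bH] := gH.
move=> e u v z Gu Hv uz vz.
have [g Gg ming] := exists_initial P_acyclic finG sG (ex_intro _ _ Gu).
have [gg gG' actG] := glueable_minimal gG Gg ming.
have [cX' _] := glue_n _ _ cX gg.
have sepG' : separated (G `\ g) H.
  apply: (IHG _ _ _ _ _ _ cX' gG') => //; last by rewrite actG.
  by move=> eqG; have := Gg; rewrite -{1}eqG => -[_]; apply.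
have [eug|neug] := pselect (u = g); last exact: (sepG' e u v z).
rewrite {}eug {Gu} in uz.
case: e uz vz => uz vz.
  have gH' : glueable n (act n (act n X [set g]) (G `\ g)) H by rewrite actG.
  have [_ disj] := glue_n _ _ cX' (glueableU gG' gH' sepG').
  apply: (disj z); last by exists v => //; right.
  by rewrite actE !faces1; split; [right|exact: (face_disjoint P_acyclic)].
have Xz : X n false z.
  by apply: bG; split; [exists g|move=> [h Gh hz]; apply: (ming h z)].
have [h Hh maxh] := exists_final P_acyclic finH sH (ex_intro _ _ Hv).
have [| |gH' _ _] := @glueable_initial n (act n X G) H (H `\ h) gH.
- by move=> ? [].
- by move=> k i y Hk [Hi _] ky iy; split=> // ekh; apply: (maxh i y) => //; rewrite -ekh.
have sepH' : separated G (H `\ h).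
  apply: IHH gH'; first by move=> ? [].
  by move=> eqH; have := Hh; rewrite -{1}eqH => -[_]; apply.
have [evh|nevh] := pselect (v = h); last exact: (sepH' false g v z).
have [_ disj] := glue_n _ _ cX (glueableU gG gH' sepH').
(* As [z] lies in [X], no element of [H] can produce it. So [z], a source of [H], would have to be
   in the top of [act n X G], where [g] has consumed it. *)
have [[k Hk kz]|nHz] := pselect (faces true H z).
  apply: (disj z) => //; exists k => //; right; split=> // ekh.
  by apply: (face_disjoint P_acyclic kz); rewrite ekh -evh.
have : act n X G n false z by apply: bH; split=> //; exists v.
by rewrite actE => -[_]; apply; exists g.
Qed.

Lemma glueable_comp n X G H : gluing_at n -> is_cell n X ->
  glueable n X G -> glueable n (act n X G) H ->
  [/\ separated G H, glueable n X (G `|` H)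
    & act n (act n X G) H = act n X (G `|` H)].
Proof.
move=> glue_n cX gG gH; have sep := glueable_separated glue_n cX gG gH.
by split=> //; [exact: glueableU|exact: actU].
Qed.

End Gluing.

(** * Boundaries and composites of families *)

Section CellBoundaries.
Context (P : omegaHypergraph).
Implicit Types (X Y : faceFamily P).

Lemma cell_dim n X i e z : is_cell n X -> X i e z -> dim z = i.
Proof. by move=> [[_ sX _ _] _ _] /sX. Qed.

Lemma cell_moves n X i e : is_cell n X -> i < n -> forall z,
  (X i false z <-> (X i true z \/ faces false (X i.+1 e) z)
                   /\ ~ faces true (X i.+1 e) z) /\
  (X i true z <-> (X i false z \/ faces true (X i.+1 e) z)
                  /\ ~ faces false (X i.+1 e) z).
Proof. by move=> [_ mvX _] ltin; apply/movesP; apply: mvX. Qed.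

Lemma cell_bd_bd n m e s X : m < n -> cell_bd e m (cell_bd s n X) = cell_bd e m X.
Proof.
move=> ltmn; apply/funext => i; apply/funext => r; rewrite /cell_bd.
have [ltim|_] := ltnP i m; first by rewrite (ltn_trans ltim).
by case: eqP => // _; rewrite ltmn.
Qed.

Lemma cell_bdP i X Y : cell_bd true i X = cell_bd false i Y <->
  (forall j e, j < i -> X j e = Y j e) /\ X i true = Y i false.
Proof.
split=> [eqXY|[lowXY topXY]].
  split=> [j e ltji|].
    by move/(congr1 (fun Z => Z j e)): eqXY; rewrite /cell_bd ltji.
  by move/(congr1 (fun Z => Z i true)): eqXY; rewrite /cell_bd ltnn eqxx.
apply/funext => j; apply/funext => e; rewrite /cell_bd.
by case: ltnP => [/lowXY//|_]; case: eqP.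
Qed.

Lemma cell_bd_id n e X : is_cell n X -> cell_bd e n X = X.
Proof.
move=> cX; apply/funext => i; apply/funext => s; rewrite /cell_bd.
case: ltngtP => // [ltni|->]; last by rewrite (cell_topE e cX) (cell_topE s cX).
by rewrite (cell_above s cX).
Qed.

Lemma cell_bd_comp n m i e X Y : i < m ->
  cell_bd e m (cell_comp n i X Y) = cell_comp m i (cell_bd e m X) (cell_bd e m Y).
Proof.
move=> ltim; apply/funext => j; apply/funext => s; rewrite /cell_bd /cell_comp ltim.
rewrite !(gtn_eqF ltim) (ltnNge m i) (ltnW ltim) /=.
case: (ltngtP j i) => [ltji|ltij|->]; last by rewrite ltim.
  by rewrite (ltn_trans ltji).
by case: ifP => // _; case: ifP => // _; rewrite setU0.
Qed.

Lemma cell_bd_comp_top n i X Y : cell_bd true i X = cell_bd false i Y ->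
  cell_bd false i (cell_comp n i X Y) = cell_bd false i X /\
  cell_bd true i (cell_comp n i X Y) = cell_bd true i Y.
Proof.
move=> /cell_bdP[lowXY _]; split; apply/funext => j; apply/funext => s.
  by rewrite /cell_bd /cell_comp ltnn eqxx; case: ifP => // ->.
by rewrite /cell_bd /cell_comp ltnn eqxx; case: ifP => // ltji; rewrite ltji lowXY.
Qed.

Lemma cell_bd_comp_low n j i e X Y : j < i -> cell_bd true i X = cell_bd false i Y ->
  cell_bd e j (cell_comp n i X Y) = cell_bd e j X /\ cell_bd e j X = cell_bd e j Y.
Proof.
move=> ltji /cell_bdP[lowXY _]; split; apply/funext => k; apply/funext => s.
  by rewrite /cell_bd /cell_comp ltji; case: ifP => // ltkj; rewrite (ltn_trans ltkj).
rewrite /cell_bd; case: ifP => [ltkj|_]; first by rewrite lowXY // (ltn_trans ltkj).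
by rewrite lowXY.
Qed.

Lemma precell_comp n i X Y : i < n -> is_precell n X -> is_precell n Y ->
  is_precell n (cell_comp n i X Y).
Proof.
move=> ltin [finX sX topX X0] [finY sY topY Y0]; split.
- move=> j e; rewrite /cell_comp; case: ifP => // _; case: ifP => _.
    by case: e.
  by rewrite finite_setU.
- move=> j e; rewrite /cell_comp; case: ifP => // _; case: eqP => [->|_].
    by case: e.
  by rewrite subUset.
- by rewrite /cell_comp ltnNge (ltnW ltin) gtn_eqF //= topX topY.
- move=> j e ltnj; have ltij := ltn_trans ltin ltnj.
  by rewrite /cell_comp ltnNge (ltnW ltij) gtn_eqF //= X0 // Y0 // setU0.
Qed.

End CellBoundaries.

(** * The gluing theorem and composition of cells *)

Section Cells.
Context (P : omegaHypergraph).
Implicit Types (G H : set P) (X Y Z : faceFamily P).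
Hypotheses (P_nonempty : non_emptiness P) (P_acyclic : acyclicity P).
Hypotheses (P_relevant : relevance P) (P_segment : segment_axiom P).

(** By non-emptiness a common generator has a target, and would clash with itself there. *)
Lemma separated_disjoint n G H z : G `<=` layer P n.+1 -> separated G H ->
  G z -> ~ H z.
Proof.
move=> sG sep Gz Hz; have [|w zw] := P_nonempty (u := z) true.
  by rewrite (sG z Gz).
exact: (sep true z z w).
Qed.

(** The two faces of [x] are disjoint by acyclicity, so taking the border of a single generator
    removes nothing. *)
Lemma atom1 n (x : P) e : dim x = n.+1 -> atom x n e = face e x.
Proof.
move=> dx; rewrite /atom dx leqnSn subSnn /= /border !faces1.
apply/seteqP; split=> z; first by case.
move=> xz; split=> // xz'.
by case: e xz xz' => xz xz'; apply: (face_disjoint P_acyclic (u := x) (z := z)).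
Qed.

Lemma atom2 n (x : P) e : dim x = n.+2 -> atom x n e = border e (face e x).
Proof.
move=> dx; rewrite -(atom1 e dx) /atom dx leqnSn subSnn.
by rewrite leqW // !subSn // subnn.
Qed.

Lemma face_fork_free n (x : P) e : dim x = n.+1 -> fork_free n (face e x).
Proof.
move=> dx; have [_ _ ff] := P_relevant x.
by rewrite -(atom1 e dx); apply: ff; rewrite dx.
Qed.

(** Relevance, read in codimension two of the atom of [x]: the source and the target of [x] perform
    the same movement. *)
Lemma border_face_moves n (x : P) e : dim x = n.+2 ->
  moves (face e x) (border false (face false x)) (border true (face true x)).
Proof.
move=> dx; have [_ mv _] := P_relevant x.
rewrite -(atom2 false dx) -(atom2 true dx) -(atom1 e dx); apply: mv.
by rewrite dx.
Qed.

(** Fork-free sets of dimension 0 are singletons, so [x] is an arrow from the point of [X] to a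
    point that differs from it by acyclicity. *)
Lemma act_cell0 X (x : P) : is_cell 0 X -> dim x = 1 ->
  face false x `<=` X 0 false ->
  is_cell 0 (act 0 X [set x]) /\ forall z, X 0 false z -> ~ face true x z.
Proof.
move=> cX dx sx.
have [b eqb] : fork_free 0 (face false x) := face_fork_free false dx.
have [c eqc] : fork_free 0 (face true x) := face_fork_free true dx.
have [a eqa] : fork_free 0 (X 0 false) by case: cX => _ _; apply.
have neq : b <> c.
  move=> ebc; apply: (face_disjoint P_acyclic (u := x) (z := c)).
    by rewrite eqc.
  by rewrite eqb ebc.
have eba : b = a by have := sx b; rewrite eqb eqa; apply.
have gx : glueable 0 X [set x].
  split=> //.
  - by move=> z ->.
  - by apply/fork_freeP => e u v z -> ->.
  - by move=> z [+ _]; rewrite faces1; apply: sx.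
split; last by rewrite eqa eqc -eba => z -> ?; apply: neq.
split.
- exact: precell_act.
- by [].
- move=> [|//] e _; exists c; rewrite /act eqxx !faces1 (cell_topE e cX).
  rewrite eqa eqb eqc eba; apply/seteqP; split=> z /=; first by case=> -[].
  by move=> ->; split; [right|rewrite -eba => ?; apply: neq].
Qed.

(* The segment axiom splits the top of X into a part U before the source of x,
   the source itself, and a part V after it; in the dimension below, replacing
   the source of x by its target between U and V does not change the movement. *)
Lemma act_cellS n X (x : P) : gluing_at P n -> is_cell n.+1 X -> dim x = n.+2 ->
  face false x `<=` X n.+1 false ->
  is_cell n.+1 (act n.+1 X [set x]) /\ forall z, X n.+1 false z -> ~ face true x z.
Proof.
move=> glue_n cX dx sx.
have [[finX sX topX X0] mvX ffX] := cX.
pose G := X n.+1 false; pose S := face false x; pose T := face true x.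
have seg : segment G S.
  rewrite /S -(atom1 false dx); apply: P_segment => //; first by rewrite dx.
  by rewrite (atom1 false dx).
pose Y := cell_bd false n X.
have cY : is_cell n Y by apply: cell_bd_cell cX _.
have [gG actG] := glueable_cell cX.
pose U := [set u | [/\ G u, ~ S u & exists2 s, S s & tri G u s]].
have sUG : U `<=` G by move=> u [].
have [| |gU gGU actGU] := glueable_initial gG (I := U) => //.
  move=> g u z Gg [Gu nSu [s Ss us]] gz uz.
  have gu : tri G g u by apply: t_step; split=> //; exists z.
  split=> //; last by exists s => //; apply: t_trans gu us.
  (* The segment axiom enters here: lying between two elements of [S], [u] would belong to [S]. *)
  by move=> Sg; apply: nSu; apply: (seg g u s).
have [| |gS gV actV] := glueable_initial gGU (I := S) => //.
- by move=> u Su; split; [exact: sx|case].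
- move=> g s z [Gg nUg] Ss gz sz; have [//|nSg] := pselect (S g).
  case: nUg; split=> //; exists s => //.
  by apply: t_step; split=> //; [exact: sx|exists z].
pose Y1 := act n Y U.
have cY1 : is_cell n Y1 by case: (glue_n _ _ cY gU).
have mvS z := (movesP _ _ _).1 (border_face_moves false dx) z.
have mvT z := (movesP _ _ _).1 (border_face_moves true dx) z.
have bS z : border false S z -> Y1 n false z by case: gS => _ _ _; apply.
have gT : glueable n Y1 T.
  split.
  - exact: face_finite.
  - by move=> z /face_dim; rewrite dx => -[].
  - exact: face_fork_free dx.
  - move=> z [T1 T2]; apply: bS; rewrite -/S in mvT *; apply/(mvT z).1.
    by split=> //; right.
have [_ disjS] := glue_n _ _ cY1 gS; have [_ disjT] := glue_n _ _ cY1 gT.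
(* By relevance [S] and [T] move the same set to the same set; as both glue onto [Y1], performing
   either gives the same result. *)
have actST : act n Y1 S = act n Y1 T.
  apply/funext => i; apply/funext => e; rewrite /act; case: eqP => // _.
  apply/seteqP; split=> z /=; rewrite (cell_topE e cY1).
    have := mvS z; have := mvT z; have := bS z; have := disjS z; have := disjT z.
    rewrite /border /= -/S -/T.
    have [] := pselect (faces true T z); have [] := pselect (faces false T z); tauto.
  have := mvS z; have := mvT z; have := bS z; have := disjS z; have := disjT z.
  rewrite /border /= -/S -/T.
  have [] := pselect (faces true S z); have [] := pselect (faces false S z); tauto.
have [sepUT gUT actUT] := glueable_comp P_acyclic glue_n cY gU gT.
rewrite -/Y1 -/Y actST actUT in gV actV.
have [sepUTV gUTV actUTV] := glueable_comp P_acyclic glue_n cY gUT gV.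
have ST z : S z -> T z -> False.
  by move=> Sz Tz; apply: (face_disjoint P_acyclic (u := x) (z := z)).
(* [G] consists of [U], [S] and the rest: separation keeps [T] away from [U] and from the rest,
   acyclicity keeps it away from [S]. *)
have disj z : G z -> ~ T z.
  move=> Gz Tz; have [Uz|nUz] := pselect (U z).
    by apply: (separated_disjoint _ sepUT) Uz Tz; move=> u /sUG; apply: sX.
  apply: (separated_disjoint _ sepUTV (z := z)).
  - by case: gUT => _ ? _ _; eassumption.
  - by right.
  - by split; [split|move=> /ST].
have eqtop : act n.+1 X [set x] n.+1 false = (U `|` T) `|` ((G `\` U) `\` S).
  apply/seteqP; split=> z; rewrite actE !faces1 -/S -/T -/G /=.
    by have [] := pselect (U z); tauto.
  have := ST z; have := sUG z; have := sx z.
  by move=> ? ? ? [[Uz|]|]; [case: (Uz)|..]; tauto.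
have gx : glueable n.+1 X [set x].
  split=> //.
  - by move=> z ->.
  - by apply/fork_freeP => e u v z -> ->.
  - by move=> z [+ _]; rewrite faces1; apply: sx.
have bd_act e : cell_bd e n (act n.+1 X [set x]) = cell_bd e n X.
  apply/funext => i; apply/funext => s; rewrite /cell_bd.
  case: ifP => [ltin|_]; first by rewrite act_ne // ltn_eqF // ltnW.
  by rewrite act_ne // ltn_eqF.
split=> //; apply: (cell_of_glue glue_n); rewrite ?bd_act ?eqtop //.
- exact: precell_act.
- by rewrite -actUTV actV actGU.
Qed.

Theorem gluing n : gluing_at P n.
Proof.
elim: n => [|n IH]; apply: (gluing_at_of_single P_acyclic) => X x cX dx sx.
  exact: act_cell0.
exact: act_cellS.
Qed.

(** If [i] has codimension one, the two tops are glued in succession. Otherwise the boundaries are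
    composed by induction, the top of [X] is performed beside the source of [Y], and then the top of
    [Y] beside the target of [X]. Separation is carried through the induction because it makes the
    tops of the composed boundaries disjoint. *)
Lemma comp_cell_separated n i X Y : i < n -> is_cell n X -> is_cell n Y ->
  cell_bd true i X = cell_bd false i Y ->
  is_cell n (cell_comp n i X Y) /\ separated (X n false) (Y n false).
Proof.
elim: n => // n IH in X Y *; rewrite ltnS => lein cX cY eqXY.
have [gX actX] := glueable_cell cX; have [gY actY] := glueable_cell cY.
have cbd Z e : is_cell n.+1 Z -> is_cell n (cell_bd e n Z).
  by move=> cZ; apply: cell_bd_cell cZ _.
have topC : cell_comp n.+1 i X Y n.+1 false = X n.+1 false `|` Y n.+1 false.
  by rewrite /cell_comp ltnNge ltnW // gtn_eqF.
have preC : is_precell n.+1 (cell_comp n.+1 i X Y).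
  by apply: precell_comp => //; [case: cX|case: cY].
move: lein; rewrite leq_eqVlt => /orP[/eqP ein|ltin].
  rewrite ein in eqXY topC preC *.
  have gY' : glueable n (act n (cell_bd false n X) (X n.+1 false)) (Y n.+1 false).
    by rewrite actX eqXY.
  have [sep gXY actXY] := glueable_comp P_acyclic (gluing (n := n)) (cbd _ _ cX) gX gY'.
  split=> //; have [bdC0 bdC1] := cell_bd_comp_top n.+1 eqXY.
  apply: (cell_of_glue (gluing (n := n)) preC); rewrite ?bdC0 ?topC //.
    exact: cbd.
  by rewrite -actXY actX eqXY actY bdC1.
have bd_eq e s : cell_bd true i (cell_bd e n X) = cell_bd false i (cell_bd s n Y).
  by rewrite !cell_bd_bd.
have comp_bd e s := IH _ _ ltin (cbd _ e cX) (cbd _ s cY) (bd_eq e s).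
(* The composite will run from [C false false] through [C true false] to [C true true]. *)
pose C e s := cell_comp n i (cell_bd e n X) (cell_bd s n Y).
have cC e s : is_cell n (C e s) by case: (comp_bd e s).
have topCE e s r : C e s n r = X n e `|` Y n s.
  by rewrite /C /cell_comp ltnNge (ltnW ltin) gtn_eqF //= /cell_bd ltnn eqxx.
have disj e s z : X n e z -> ~ Y n s z.
  move=> Xz Yz; have [_] := comp_bd e s; rewrite /cell_bd !ltnn eqxx => sep.
  (* Since [i < n], [n] is a successor, so the generators of these tops have faces and separation
     implies disjointness. *)
  case: n => // m in IH X Y cX cY gX actX gY actY cbd topC preC ltin eqXY bd_eq
             comp_bd C cC topCE Xz Yz sep *.
  apply: (separated_disjoint _ sep Xz Yz).
  by case: cX => -[_ sX _ _] _ _; apply: sX.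
have [_ _ _ bX] := gX; have [_ _ _ bY] := gY.
have bdE Z : cell_bd false n Z n false = Z n false by rewrite /cell_bd ltnn eqxx.
rewrite !bdE in bX bY.
have mvX := cell_moves false cX (ltnSn n).
have mvY := cell_moves false cY (ltnSn n).
have gXC : glueable n (C false false) (X n.+1 false).
  by case: gX => ? ? ? _; split=> // z /bX; rewrite topCE; left.
have gYC : glueable n (C true false) (Y n.+1 false).
  by case: gY => ? ? ? _; split=> // z /bY; rewrite topCE; right.
have [_ disjX] := gluing (cC _ _) gXC; have [_ disjY] := gluing (cC _ _) gYC.
have act_C G (Z Z' : faceFamily P) : (forall j r, j != n -> Z j r = Z' j r) ->
    (forall z r, Z' n r z <-> (Z n r z \/ faces true G z) /\ ~ faces false G z) ->
    act n Z G = Z'.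
  move=> low top; apply/funext => j; apply/funext => r; rewrite /act.
  case: eqP => [->|/eqP]; last exact: low.
  by apply/seteqP; split=> z /=; rewrite top.
have lowC e s e' s' j r : j != n -> C e s j r = C e' s' j r.
  move=> nejn; rewrite /C /cell_comp /cell_bd ltin (negbTE nejn).
  by case: ifP => [ltji|_]; [rewrite (ltn_trans ltji ltin)|].
have actXC : act n (C false false) (X n.+1 false) = C true false.
  apply: act_C => [j r|z r]; first exact: lowC.
  rewrite !topCE /=; have [] := mvX z; have := disj true false z.
  have := disj false false z; have := disjX z; rewrite topCE /=.
  have [] := pselect (faces false (X n.+1 false) z).
    have [] := pselect (faces true (X n.+1 false) z); have := bX z;
    rewrite /border /=; tauto.
  tauto.
have actYC : act n (C true false) (Y n.+1 false) = C true true.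
  apply: act_C => [j r|z r]; first exact: lowC.
  rewrite !topCE /=; have [] := mvY z; have := disj true false z.
  have := disj true true z; have := disjY z; rewrite topCE /=.
  have [] := pselect (faces false (Y n.+1 false) z).
    have [] := pselect (faces true (Y n.+1 false) z); have := bY z;
    rewrite /border /=; tauto.
  tauto.
have gYC' : glueable n (act n (C false false) (X n.+1 false)) (Y n.+1 false).
  by rewrite actXC.
have [sep gXY actXY] := glueable_comp P_acyclic (gluing (n := n)) (cC _ _) gXC gYC'.
split=> //; apply: (cell_of_glue (gluing (n := n)) preC); rewrite ?cell_bd_comp ?topC //.
  exact: cC.
by rewrite -actXY actXC actYC.
Qed.

Lemma comp_cell n i X Y : i < n -> is_cell n X -> is_cell n Y ->
  cell_bd true i X = cell_bd false i Y -> is_cell n (cell_comp n i X Y).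
Proof. by move=> ltin cX cY eqXY; case: (comp_cell_separated ltin cX cY eqXY). Qed.

Lemma tri_trans_layer n G u v : G `<=` layer P n -> tri G u v -> tri (layer P n) u v.
Proof.
move=> sG; elim=> [x y [Gx Gy xy]|x y z _ xy _ yz].
  by apply: t_step; split=> //; apply: sG.
exact: t_trans xy yz.
Qed.

(* Performing only the part of the top of X that comes before y (with y
   included for its target) yields a cell that has z in its top. *)
Lemma cell_through_face n X y e z : is_cell n.+1 X -> X n.+1 false y ->
  face e y z ->
  exists W, [/\ is_cell n W, W n false z & forall j s, j < n -> W j s = X j s].
Proof.
move=> cX Xy yz; have [gX actX] := glueable_cell cX.
have [_ sG _ _] := gX; set G := X n.+1 false in gX actX sG Xy.
have t_irr u : ~ tri G u u.
  by move=> /(tri_trans_layer sG); apply: P_acyclic.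
have cbd : is_cell n (cell_bd false n X) by apply: cell_bd_cell cX _.
pose I := [set u | G u /\ (tri G u y \/ e /\ u = y)].
have [| |gI gJ actI] := glueable_initial gX (I := I).
- by move=> u [].
- move=> g i x Gg [Gi tiy] gx ix; split=> //; left.
  have gi : tri G g i by apply: t_step; split=> //; exists x.
  by case: tiy => [|[_ <-] //]; apply: t_trans gi.
exists (act n (cell_bd false n X) I); split.
- by case: (gluing cbd gI).
- case: e yz @I gI gJ actI => yz I gI gJ actI.
    rewrite actE; split; first by right; exists y => //; split=> //; right.
    move=> [i [Gi [tiy|[_ eiy]]] iz]; last first.
      by apply: (face_disjoint P_acyclic yz); rewrite -eiy.
    apply: (t_irr y); apply: t_trans tiy.
    by apply: t_step; split=> //; exists z.
  have [_ _ _ bJ] := gJ; apply: bJ; split.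
    by exists y => //; split=> // -[_ [/t_irr|[]]].
  move=> [g [Gg nIg] gz]; apply: nIg; split=> //; left.
  by apply: t_step; split=> //; exists z.
- by move=> j s ltjn; rewrite act_ne ?ltn_eqF // /cell_bd ltjn.
Qed.

(** Starting from the boundary of [X] in dimension [l], one descends along the chain from [y] to [w]
    with [cell_through_face]; no step alters the components below the new top. *)
Lemma cell_through n X l e y w : is_cell n X -> l <= n -> X l e y -> Rel y w ->
  exists W, [/\ is_cell (dim w) W, W (dim w) false w, dim w <= l
    & forall j s, j < dim w -> W j s = X j s].
Proof.
move=> cX leln Xy.
have dy : dim y = l by case: cX => -[_ sX _ _] _ _; apply: (sX l e y).
pose Q v := exists W, [/\ is_cell (dim v) W, W (dim v) false v, dim v <= l
    & forall j s, j < dim v -> W j s = X j s].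
have Qy : Q y.
  exists (cell_bd e l X); rewrite /Q dy; split=> //.
  - exact: cell_bd_cell cX _.
  - by rewrite /cell_bd ltnn eqxx.
  - by move=> j s ltjl; rewrite /cell_bd ltjl.
move=> yw; elim: yw {Xy dy} Qy => {y w} [y w yw|//|y v w _ IH1 _ IH2 /IH1/IH2 //].
move=> [W [cW Wy ley lowW]].
have [s {}yw] : exists s, face s y w by case: yw; [exists false|exists true].
have dy := face_dim yw; rewrite dy in cW Wy ley lowW.
have [W' [cW' W'w lowW']] := cell_through_face cW Wy yw.
exists W'; split=> // [|j r ltjw]; first exact: ltnW.
by rewrite lowW' // lowW // ltnW.
Qed.
End Cells.

(** * Iterated boundaries and identities on underlying elements *)

Lemma sval_eq (T : Type) (D : T -> Prop) (u v : {x | D x}) : sval u = sval v -> u = v.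
Proof.
case: u v => [x Dx] [y Dy] /= eqxy.
by case: y / eqxy Dy => Dy; congr exist; apply: Prop_irrelevance.
Qed.

Section SubOmega.
Variables (O : totalOps) (D : nat -> car O -> Prop).

Fixpoint obd_iter e i k (X : car O) : car O :=
  if k is k'.+1 then obd_iter e i k' (@obd O e (k' + i) X) else X.

Lemma sval_bd_to (hb : bd_closed D) e n i (h : i <= n) (u : sub_glob hb n) :
  sval (bd_to e h u) = obd_iter e i (n - i) (sval u).
Proof.
have iterE k (v : sub_glob hb (k + i)) :
    sval (@bd_iter (sub_glob hb) e i k v) = obd_iter e i k (sval v).
  by elim: k v => //= k IH v; rewrite IH.
rewrite /bd_to iterE; congr obd_iter.
by move: (esym (subnK h)); move: (n - i + i) => m eqm; case: m / eqm.
Qed.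

Lemma sval_id_to (hD : closed_ops O D) n i (h : i <= n) (u : sub_omega hD i) :
  (forall m X, @oid O m X = X) -> sval (id_to h u) = sval u.
Proof.
move=> oidE; rewrite /id_to.
have iterE k : sval (@id_iter (sub_omega hD) i k u) = sval u.
  by elim: k => //= k IH; rewrite oidE.
by rewrite -[RHS](iterE (n - i)); move: (id_iter _ _) (subnK h);
  move: (n - i + i) => m v eqm; case: n / eqm h.
Qed.

Lemma composableP (hb : bd_closed D) n i (h : i < n) (u v : sub_glob hb n) :
  composable h u v <->
  obd_iter true i (n - i) (sval u) = obd_iter false i (n - i) (sval v).
Proof.
rewrite /composable; split=> [/(congr1 sval)|eq_uv].
  by rewrite !sval_bd_to.
by apply: sval_eq; rewrite !sval_bd_to.
Qed.

End SubOmega.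

(** * The category of cells *)

Section CellCategory.
Context (P : omegaHypergraph).
Implicit Types (X Y : faceFamily P).

Lemma cell_obd_iter e n i X : i <= n -> is_cell n X ->
  @obd_iter (cell_ops P) e i (n - i) X = cell_bd e i X.
Proof.
move=> lein; rewrite -{1}(subnK lein); move: (n - i) => k.
elim: k X => [|k IH] X cX; first by rewrite cell_bd_id.
have cX' : is_cell (k + i) (cell_bd e (k + i) X) by apply: cell_bd_cell cX _.
(* For [k = 0] both boundaries are taken in dimension [i], where [cell_bd_bd] does not apply but the
   outer one is trivial. *)
rewrite /= IH //; case: k {IH} cX cX' => [|k] cX cX'; last first.
  by rewrite cell_bd_bd // addSn ltnS leq_addl.
by rewrite (cell_bd_id e cX').
Qed.

(** The empty set moves [X n false] to [X n true] because these are equal. *)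
Lemma cell_id n X : is_cell n X -> is_cell n.+1 X.
Proof.
case=> -[finX sX topX X0] mvX ffX; split; first split=> //.
- by rewrite !X0.
- by move=> i e ltni; apply: X0; apply: ltnW.
- move=> i e; rewrite ltnS leq_eqVlt => /orP[/eqP->|]; last exact: mvX.
  apply/movesP => z; rewrite /faces (X0 n.+1 e) // !bigcup_set0 topX.
  by have : ~ (set0 : set P) z by []; tauto.
- move=> i e; rewrite leq_eqVlt => /orP[/eqP->|]; last exact: ffX.
  by rewrite X0.
Qed.

Lemma cell_composableP (hb : bd_closed (O := cell_ops P) (@is_cell P)) n i
    (h : i < n) (u v : sub_glob hb n) :
  composable h u v <-> cell_bd true i (sval u) = cell_bd false i (sval v).
Proof.
rewrite composableP !cell_obd_iter ?(ltnW h) //; [exact: (svalP v)|exact: (svalP u)].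
Qed.

Lemma sval_cell_bd_to (hC : closed_ops (cell_ops P) (@is_cell P)) e n i
    (h : i <= n) (u : Cell hC n) : sval (bd_to e h u) = cell_bd e i (sval u).
Proof. by rewrite sval_bd_to cell_obd_iter //; apply: (svalP u). Qed.

Lemma sval_cell_id_to (hC : closed_ops (cell_ops P) (@is_cell P)) n i
    (h : i <= n) (u : Cell hC i) : sval (id_to h u : Cell hC n) = sval u.
Proof. exact: sval_id_to. Qed.

Lemma cell_comp_idl n i X : cell_comp n i (cell_bd false i X) X = X.
Proof.
apply/funext => j; apply/funext => e; rewrite /cell_comp /cell_bd ltnn eqxx.
by case: ltngtP => // [_|->]; [rewrite set0U|case: e].
Qed.

Lemma cell_comp_idr n i X : cell_comp n i X (cell_bd true i X) = X.
Proof.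
apply/funext => j; apply/funext => e; rewrite /cell_comp /cell_bd ltnn eqxx.
by case: ltngtP => // [_|->]; [rewrite setU0|case: e].
Qed.

Lemma cell_compA n i X Y Z :
  cell_comp n i (cell_comp n i X Y) Z = cell_comp n i X (cell_comp n i Y Z).
Proof.
apply/funext => j; apply/funext => e; rewrite /cell_comp ltnn eqxx.
by case: ltngtP => // _; rewrite setUA.
Qed.

Lemma cell_exchange n i j X X' Y Y' : i < j ->
  cell_comp n j (cell_comp n i X X') (cell_comp n i Y Y') =
  cell_comp n i (cell_comp n j X Y) (cell_comp n j X' Y').
Proof.
move=> ltij; apply/funext => k; apply/funext => e; rewrite /cell_comp.
rewrite ltij (ltnNge j i) (ltnW ltij) (gtn_eqF ltij) /=.
case: (ltngtP k i) => [ltki|ltik|eqki]; first by rewrite (ltn_trans ltki).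
  case: (ltngtP k j) => // [_|_]; first exact: setUACA.
  by case: e.
by rewrite eqki ltij.
Qed.

(** The operations are formulas on families, so each law reduces to an identity of families and each
    composability claim to an equality of boundaries. *)
Lemma cell_omega_cat (hC : closed_ops (cell_ops P) (@is_cell P)) :
  strict_omega_cat (Cell hC).
Proof.
split.
- move=> n e u; apply: sval_eq.
  by rewrite /= !cell_bd_bd.
- move=> n e u; apply: sval_eq; rewrite /=.
  exact: cell_bd_id (svalP u).
- move=> n h u v c; have /cell_composableP c0 := c.
  have [bd0 bd1] := cell_bd_comp_top n.+1 c0.
  by split; apply: sval_eq; [exact: bd0|exact: bd1].
- move=> n i h h' e u v c; have /cell_composableP c0 := c.
  unshelve eexists; last by apply: sval_eq => /=; apply: cell_bd_comp.
  by apply/cell_composableP; rewrite /= !cell_bd_bd.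
- move=> n i h u; unshelve eexists; last first.
    by apply: sval_eq; rewrite /= sval_cell_id_to sval_cell_bd_to cell_comp_idl.
  apply/cell_composableP; rewrite sval_cell_id_to sval_cell_bd_to cell_bd_id //.
  by apply: cell_bd_cell (svalP u) _; apply: ltnW.
- move=> n i h u; unshelve eexists; last first.
    by apply: sval_eq; rewrite /= sval_cell_id_to sval_cell_bd_to cell_comp_idr.
  apply/cell_composableP; rewrite sval_cell_id_to sval_cell_bd_to [RHS]cell_bd_id //.
  by apply: cell_bd_cell (svalP u) _; apply: ltnW.
- move=> n i h u v w c1 c2.
  have /cell_composableP e1 := c1; have /cell_composableP e2 := c2.
  unshelve eexists; last unshelve eexists; last by apply: sval_eq; apply: cell_compA.
    by apply/cell_composableP; have [_ /= ->] := cell_bd_comp_top n e1.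
  by apply/cell_composableP; have [/= -> _] := cell_bd_comp_top n e2.
- move=> n i h h' u v c; have /cell_composableP c0 := c.
  by unshelve eexists; [apply/cell_composableP|apply: sval_eq].
- move=> n i j hi hj u u' v v' ci ci' cj cj' ltij.
  have /cell_composableP eci := ci; have /cell_composableP eci' := ci'.
  have /cell_composableP ecj := cj; have /cell_composableP ecj' := cj'.
  unshelve eexists; last unshelve eexists; last by apply: sval_eq; apply: cell_exchange.
    by apply/cell_composableP; rewrite /= !cell_bd_comp // ecj ecj'.
  apply/cell_composableP; rewrite /=.
  have [-> _] := cell_bd_comp_low n true ltij ecj.
  by have [-> _] := cell_bd_comp_low n false ltij ecj'.
Qed.

End CellCategory.

(** * Transport along an isomorphism *)

Section Transport.
Variables (C D : omegaData) (F : forall n, C n -> D n) (G : forall n, D n -> C n).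
Arguments F : clear implicits.
Arguments G : clear implicits.
Hypotheses (functorF : omega_functor F).
Hypotheses (FK : forall n, cancel (F n) (G n)) (GK : forall n, cancel (G n) (F n)).

Lemma functor_bd_to e n i (h : i <= n) (u : C n) :
  F i (bd_to e h u) = bd_to e h (F n u).
Proof.
have iterE k (v : C (k + i)) : F i (bd_iter e v) = bd_iter e (F _ v).
  by elim: k v => //= k IH v; rewrite IH (functor_bd functorF).
rewrite /bd_to iterE; congr bd_iter.
by move: (esym (subnK h)); move: (n - i + i) => m eqm; case: m / eqm.
Qed.

Lemma functor_id_to n i (h : i <= n) (u : C i) :
  F n (id_to h u) = id_to h (F i u).
Proof.
have iterE k : F _ (id_iter k u) = id_iter k (F i u).
  by elim: k => //= k IH; rewrite (functor_id functorF) IH.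
rewrite /id_to -iterE; move: (id_iter _ _) (subnK h).
by move: (n - i + i) => m v eqm; case: n / eqm h.
Qed.

Lemma functor_composable n i (h : i < n) (u v : C n) :
  composable h (F n u) (F n v) -> composable h u v.
Proof.
by rewrite /composable -!functor_bd_to => /(congr1 (G i)); rewrite !FK.
Qed.

(** Composition as a relation does not depend on a chosen proof of composability, and so can be
    carried along [F] in both directions. *)
Definition composite (E : omegaData) n i (h : i < n) (u v w : E n) : Prop :=
  exists c : composable h u v, compc c = w.

Lemma compositeF n i (h : i < n) (u v w : C n) :
  composite h u v w <-> composite h (F n u) (F n v) (F n w).
Proof.
split=> [[c <-]|[c]].
  by have [c' ->] := functor_comp functorF c; exists c'.
have c0 := functor_composable c; have [c' Fc'] := functor_comp functorF c0.
rewrite (Prop_irrelevance c c') -Fc' => /(congr1 (G n)); rewrite !FK => <-.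
by exists c0.
Qed.

Lemma inverse_functor : omega_functor G.
Proof.
split=> [n e u|n u|n i h u v c].
- by rewrite -{1}(GK u) -(functor_bd functorF) FK.
- by rewrite -{1}(GK u) -(functor_id functorF) FK.
suff [c' <-] : composite h (G n u) (G n v) (G n (compc c)) by exists c'.
by apply/compositeF; rewrite !GK; exists c.
Qed.

Lemma transport_omega_cat : strict_omega_cat C -> strict_omega_cat D.
Proof.
case=> globC bdidC topC lowC idlC idrC assC idcC exC.
(* Used below as an eliminator, replacing each variable of [D] by the image of one of [C]. *)
have Fsurj n (Q : D n -> Prop) : (forall u, Q (F n u)) -> forall u, Q u.
  by move=> QF u; rewrite -(GK u).
have comp_lift n i (h : i < n) u v (c : composable h (F n u) (F n v)) :
    exists2 c0 : composable h u v, True & compc c = F n (compc c0).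
  have c0 := functor_composable c; exists c0 => //.
  by have [c' ->] := functor_comp functorF c0; rewrite (Prop_irrelevance c c').
split.
- move=> n e; elim/Fsurj=> u; rewrite -!(functor_bd functorF).
  by rewrite globC.
- move=> n e; elim/Fsurj=> u.
  by rewrite -(functor_id functorF) -(functor_bd functorF) bdidC.
- move=> n h; elim/Fsurj=> u; elim/Fsurj=> v c.
  have [c0 _ ->] := comp_lift _ _ _ _ _ c; rewrite -!(functor_bd functorF).
  by have [-> ->] := topC _ _ _ _ c0.
- move=> n i h h' e; elim/Fsurj=> u; elim/Fsurj=> v c.
  have [c0 _ ->] := comp_lift _ _ _ _ _ c; rewrite -!(functor_bd functorF).
  have [c1 eq1] := lowC _ _ h _ e _ _ c0.
  suff [c2 eq2] : composite h (F n (bd e u)) (F n (bd e v)) (F n (bd e (compc c0))).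
    by exists c2; rewrite eq2.
  by apply/(compositeF h); exists c1.
- move=> n i h; elim/Fsurj=> u; rewrite -functor_bd_to -functor_id_to.
  by apply/(compositeF h); apply: idlC.
- move=> n i h; elim/Fsurj=> u; rewrite -functor_bd_to -functor_id_to.
  by apply/(compositeF h); apply: idrC.
- move=> n i h; elim/Fsurj=> u; elim/Fsurj=> v; elim/Fsurj=> w c1 c2.
  have [d1 _ ->] := comp_lift _ _ _ _ _ c1; have [d2 _ ->] := comp_lift _ _ _ _ _ c2.
  have [d3 [d4 eq34]] := assC _ _ _ _ _ _ d1 d2.
  have [c3 eq3] := functor_comp functorF d3; have [c4 eq4] := functor_comp functorF d4.
  by exists c3, c4; rewrite -eq3 -eq4 eq34.
- move=> n i h h'; elim/Fsurj=> u; elim/Fsurj=> v c.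
  have [d _ ->] := comp_lift _ _ _ _ _ c; rewrite -!(functor_id functorF).
  have [d' ->] := idcC _ _ _ h' _ _ d.
  exact: (functor_comp functorF d').
- move=> n i j hi hj + + + +.
  elim/Fsurj=> u; elim/Fsurj=> u'; elim/Fsurj=> v; elim/Fsurj=> v' ci ci' cj cj' ltij.
  have [di _ ->] := comp_lift _ _ _ _ _ ci; have [di' _ ->] := comp_lift _ _ _ _ _ ci'.
  have [dj _ ->] := comp_lift _ _ _ _ _ cj; have [dj' _ ->] := comp_lift _ _ _ _ _ cj'.
  have [ej [ei eq]] := exC _ _ _ _ _ _ _ _ _ di di' dj dj' ltij.
  have [fj eqj] := functor_comp functorF ej; have [fi eqi] := functor_comp functorF ei.
  by exists fj, fi; rewrite -eqj -eqi eq.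
Qed.

End Transport.

(** * Maximal elements *)

Section Rel.
Context (P : omegaHypergraph).
Implicit Types (A B : set P).

Lemma Rel_face e (x y : P) : face e x y -> Rel x y.
Proof. by move=> xy; apply: rt_step; case: e xy; [right|left]. Qed.

Lemma Rel_last (x z : P) : Rel x z -> x <> z ->
  exists w e, Rel x w /\ face e w z.
Proof.
move=> xz nexz; suff [//|//] : x = z \/ exists w e, Rel x w /\ face e w z.
elim: xz {nexz} => {x z} [x z [] xz|x|x y z xy IHxy yz IHyz].
- by right; exists x, false; split=> //; apply: rt_refl.
- by right; exists x, true; split=> //; apply: rt_refl.
- by left.
- case: IHyz => [<- //|[w [e [yw wz]]]].
  by right; exists w, e; split=> //; apply: rt_trans yw.
Qed.

(** Passing to a face lowers the dimension; this makes [Rel] antisymmetric. *)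
Lemma Rel_dim (x y : P) : Rel x y -> x = y \/ dim y < dim x.
Proof.
elim=> {x y} [x y [] /face_dim ->|x|x y z _ + _]; [by right|by right|by left|].
by move=> [->//|ltyx] [<-|ltzy]; right=> //; apply: ltn_trans ltyx.
Qed.

Lemma Rel_antisym (x y : P) : Rel x y -> Rel y x -> x = y.
Proof.
by move=> /Rel_dim[//|ltyx] /Rel_dim[//|/ltn_trans/(_ ltyx)]; rewrite ltnn.
Qed.

Lemma subset_Rclosure A : A `<=` Rclosure A.
Proof. by move=> x Ax; exists x => //; apply: rt_refl. Qed.

Lemma RclosureU A B : Rclosure (A `|` B) = Rclosure A `|` Rclosure B.
Proof.
apply/seteqP; split=> y.
  by case=> x [Ax|Bx] xy; [left|right]; exists x.
by case=> -[x Ux xy]; exists x => //; [left|right].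
Qed.

Lemma Rclosure_subset A B : A `<=` Rclosure B -> Rclosure A `<=` Rclosure B.
Proof.
by move=> sAB y [x /sAB[b Bb bx] xy]; exists b => //; apply: rt_trans xy.
Qed.

(** The bound on dimensions forces any climb from an element of [A] to strictly larger ones to end
    at a maximal one. *)
Lemma Rclosure_max_part n A : (forall x, A x -> dim x <= n) ->
  Rclosure (max_part A) = Rclosure A.
Proof.
move=> dimA; apply/seteqP; split; apply: Rclosure_subset.
  by move=> x [Ax _]; apply: subset_Rclosure.
move=> x; have [k] := ubnP (n - dim x); elim: k x => // k IH x.
rewrite ltnS => lek Ax; have [maxx|nmaxx] := pselect (max_part A x).
  exact: subset_Rclosure.
have [y [Ay yx neyx]] : exists y, [/\ A y, Rel y x & y <> x].
  apply: contrapT => noy; apply: nmaxx; split=> // y Ay yx.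
  by apply: contrapT => neyx; apply: noy; exists y.
have [//|ltxy] := Rel_dim yx.
have [|//|z maxz zy] := IH y.
  apply: leq_trans lek; apply: ltn_sub2l => //.
  exact: leq_trans (dimA y Ay).
by exists z => //; apply: rt_trans yx.
Qed.

Lemma max_part_Rclosure A : max_part (Rclosure A) = max_part A.
Proof.
apply/seteqP; split=> x [].
  move=> [a Aa ax] maxx; have eax := maxx _ (subset_Rclosure Aa) ax.
  rewrite -eax in maxx *; split=> // y Ay; apply: maxx.
  exact: subset_Rclosure.
move=> Ax maxx; split=> [|y [a Aa ay] yx]; first exact: subset_Rclosure.
have eax : a = x by apply: maxx => //; apply: rt_trans yx.
by apply: Rel_antisym => //; rewrite -eax.
Qed.

Lemma max_part_id A : max_part (max_part A) = max_part A.
Proof.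
apply/seteqP; split=> x [] // Ax maxx; split=> [|y [Ay _]]; first by split.
exact: maxx.
Qed.

End Rel.

(** * Cells and maximal-well-formed sets *)

Section Support.
Context (P : omegaHypergraph).
Implicit Types (A B S : set P) (X Y : faceFamily P).

(** For a cell this is the set of maximal elements of its union, by [max_cell_union]; this form
    avoids [Rel] and lets boundaries be computed componentwise. *)
Definition cell_support X : set P := [set z | forall e, X (dim z) e z].

Lemma cell_support_top n X : is_cell n X ->
  cell_support X `&` layer P n = X n false.
Proof.
move=> cX; apply/seteqP; split=> z; first by case=> Xz <-.
move=> Xz; have dz := cell_dim cX Xz; split=> // -[] //; rewrite dz //.
by rewrite (cell_topE true cX).
Qed.

(** An element of [X n e] is either left in place by the top of [X], and then lies in both
    [X n false] and [X n true], or is moved, and then lies in the border. *)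
Lemma max_bd_support n e X : is_cell n.+1 X ->
  max_bd e n (cell_support X) = cell_support (cell_bd e n X).
Proof.
move=> cX; rewrite /max_bd (cell_support_top cX).
have mv z := cell_moves false cX (ltnSn n) z.
apply/seteqP; split=> z.
- case=> [[Xz lezn] s|bz s].
    move: lezn; rewrite /= /cell_bd; case: ltngtP => // dz _.
    by rewrite -dz; apply: (Xz e).
  have dz : dim z = n.
    by case: bz => -[x /(cell_dim cX) dx /face_dim]; rewrite dx => -[].
  rewrite dz /cell_bd ltnn eqxx; have := mv z; case: bz; case: e => /=; tauto.
- move=> Xz; have := Xz false; rewrite {1}/cell_bd; case: ltngtP => // [ltzn _|dz {}Xz].
    left; split; last exact: ltnW.
    by move=> s; have := Xz s; rewrite /cell_bd ltzn.
  have [b|nb] := pselect (border e (X n.+1 false) z); first by right.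
  left; split; last by rewrite /= dz.
  rewrite /cell_support /= dz; have := mv z; move: nb; rewrite /border /=.
  case: e Xz => Xz + + [] /=; have [] := pselect (faces true (X n.+1 false) z);
    have [] := pselect (faces false (X n.+1 false) z); tauto.
Qed.

Lemma maxwf_obd_iter e n i X : i <= n -> is_cell n X ->
  @obd_iter (maxwf_ops P) e i (n - i) (cell_support X) =
  cell_support (cell_bd e i X).
Proof.
move=> lein; rewrite -{1}(subnK lein); move: (n - i) => k.
elim: k X => [|k IH] X cX; first by rewrite cell_bd_id.
have cX' : is_cell (k + i) (cell_bd e (k + i) X) by apply: cell_bd_cell cX _.
rewrite /= max_bd_support // IH //; case: k {IH} cX cX' => [|k] cX cX'; last first.
  by rewrite cell_bd_bd // addSn ltnS leq_addl.
by rewrite (cell_bd_id e cX').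
Qed.

(** The support determines the top directly and the source by induction; a cell is glued from these
    two. *)
Lemma cell_support_inj n X Y : is_cell n X -> is_cell n Y ->
  cell_support X = cell_support Y -> X = Y.
Proof.
elim: n X Y => [|n IH] X Y cX cY eqXY.
  have top : X 0 false = Y 0 false.
    by rewrite -(cell_support_top cX) eqXY (cell_support_top cY).
  apply/funext => -[|i]; apply/funext => e.
    by rewrite (cell_topE e cX) (cell_topE e cY).
  by rewrite (cell_above _ cX) // (cell_above _ cY).
have top : X n.+1 false = Y n.+1 false.
  by rewrite -(cell_support_top cX) eqXY (cell_support_top cY).
have bd0 : cell_bd false n X = cell_bd false n Y.
  by apply: IH; [exact: cell_bd_cell cX _|exact: cell_bd_cell cY _|];
    rewrite -!max_bd_support // eqXY.
have [_ actX] := glueable_cell cX; have [_ actY] := glueable_cell cY.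
have [[pX _ _] [pY _ _]] := (cX, cY).
by rewrite (precell_eq_glue pX actX) (precell_eq_glue pY actY) bd0 top.
Qed.

Lemma maxwf_bd n e S : is_maxwf n.+1 S -> is_maxwf n (max_bd e n S).
Proof. by case=> _ _ _ [bdS _]; apply: bdS. Qed.

Lemma maxwf_globular n e S : is_maxwf n.+2 S ->
  max_bd e n (max_bd false n.+1 S) = max_bd e n (max_bd true n.+1 S).
Proof. by case=> _ _ _ [_ globS]; apply: globS. Qed.

Lemma maxwf_fgs n S : is_maxwf n S -> is_fgs n S.
Proof. by case: n => [|n] []. Qed.

Lemma maxwf_max n S : is_maxwf n S -> max_part S = S.
Proof. by case: n => [|n] []. Qed.

Lemma maxwf_fork_free n S : is_maxwf n S -> fork_free n (S `&` layer P n).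
Proof. by case: n => [|n] []. Qed.

(** By induction the source and target of [S] are supports of cells. Globularity of [S] and
    injectivity of the support make these cells parallel, and the top of [S] is put between them. *)
Lemma maxwf_support n S : is_maxwf n S ->
  exists2 X, is_cell n X & cell_support X = S.
Proof.
elim: n S => [|n IH] S wfS.
  have [finS dimS] := maxwf_fgs wfS.
  have S0 : S `&` layer P 0 = S.
    by apply: setIidl => z /dimS; rewrite leqn0 => /eqP.
  exists (fun i _ => if i == 0 then S else set0); last first.
    apply/seteqP; split=> z Xz.
      by have := Xz true; case: eqP.
    by move=> e; move/dimS: (Xz); rewrite leqn0 => ->.
  split=> //; first split=> //.
  - by move=> [].
  - by move=> [|i] e z //=; rewrite -S0 => -[].
  - by move=> [].
  - by move=> [|//] e _; have := maxwf_fork_free wfS; rewrite S0.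
have [finS dimS] := maxwf_fgs wfS.
have [X0 cX0 eqX0] := IH _ (maxwf_bd false wfS).
have [X1 cX1 eqX1] := IH _ (maxwf_bd true wfS).
pose M := S `&` layer P n.+1.
have low i e : i < n -> X0 i e = X1 i e.
  case: n => // n in IH S wfS finS dimS X0 cX0 eqX0 X1 cX1 eqX1 M *.
  move=> ltin; have bdE s : cell_bd s n X0 = cell_bd s n X1.
    apply: cell_support_inj; [exact: cell_bd_cell cX0 _|exact: cell_bd_cell cX1 _|].
    by rewrite -!max_bd_support // eqX0 eqX1 maxwf_globular.
  have := congr1 (fun Z => Z i e) (bdE e); rewrite /cell_bd.
  move: ltin; rewrite ltnS leq_eqVlt => /orP[/eqP->|->//].
  by rewrite ltnn eqxx.
have X0z z : X0 n false z <-> max_bd false n S z /\ dim z = n.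
  by rewrite -(cell_support_top cX0) eqX0.
have X1z z : X1 n false z <-> max_bd true n S z /\ dim z = n.
  by rewrite -(cell_support_top cX1) eqX1.
(* By maximality of [S]; the elements of [S] of dimension [n] are therefore left in place by the
   movement along [M]. *)
have maxS e z : S z -> ~ faces e M z.
  move=> Sz [x [Sx _] xz]; move: (Sz); rewrite -{1}(maxwf_max wfS).
  move=> -[_ /(_ x Sx (Rel_face xz)) exz].
  by have := face_dim xz; rewrite exz => /eqP; rewrite -[X in X == _]addn0 -addn1 eqn_add2l.
have borderM e z : border e M z -> dim z = n.
  by move=> [[x [_ dx] /face_dim]]; rewrite [dim x]dx => -[].
pose X i (e : bool) : set P :=
  if i == n.+1 then M else if e then X1 i true else X0 i false.
have Xn z e : X n e z <-> (S z /\ dim z = n) \/ border e M z.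
  rewrite /X ltn_eqF //; have := borderM e z; case: e => bM.
    rewrite (cell_topE _ cX1) X1z /max_bd -/M /=; split; last first.
      move=> [[Sz dz]|bz]; last by split; [right|apply: bM].
    by split=> //; left; split; rewrite //= dz.
    by move=> [[[? _]|?] ?]; [left|right].
  rewrite X0z /max_bd -/M /=; split; last first.
    move=> [[Sz dz]|bz]; last by split; [right|apply: bM].
    by split=> //; left; split; rewrite //= dz.
  by move=> [[[? _]|?] ?]; [left|right].
have [[[fin0 s0 top0 ab0] mv0 ff0] [[fin1 s1 top1 ab1] mv1 ff1]] := (cX0, cX1).
exists X.
  split; first split.
  - move=> i e; rewrite /X; case: eqP => _; first exact: finite_setIl.
    by case: e.
  - move=> i e; rewrite /X; case: eqP => [->|_]; first exact: subIsetr.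
    by case: e.
  - by rewrite /X eqxx.
  - move=> i e ltni; rewrite /X gtn_eqF //.
    by case: e; [apply: ab1|apply: ab0]; apply: ltnW.
  - move=> i e; rewrite ltnS leq_eqVlt => /orP[/eqP->|ltin].
      apply/movesP => z; have -> : X n.+1 e = M by rewrite /X eqxx.
      have := Xn z false; have := Xn z true; have := maxS false z; have := maxS true z.
      rewrite /border /=.
      have [] := pselect (faces false M z); have [] := pselect (faces true M z); tauto.
    have := mv0 i e ltin; have := mv1 i e ltin.
    rewrite /X eqSS !(ltn_eqF ltin) (ltn_eqF (leqW ltin)).
    by case: e; rewrite (low i false ltin) ?(low i true ltin).
  - move=> i e; rewrite leq_eqVlt => /orP[/eqP->|].
      by rewrite /X eqxx; apply: maxwf_fork_free.
    rewrite ltnS => lein; rewrite /X ltn_eqF ?ltnS //.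
    by case: e; [apply: ff1|apply: ff0].
have supportX z : cell_support X z <-> S z.
  have [ltzn|ltnz|dz] := ltngtP (dim z) n.
  - have XE e : X (dim z) e = X0 (dim z) e.
      by rewrite /X ltn_eqF ?leqW //; case: e; rewrite ?low.
    have -> : cell_support X z <-> cell_support X0 z.
      by split=> Xz e; have := Xz e; rewrite XE.
    rewrite eqX0; split; last by left; split=> //; apply: ltnW.
    by move=> [[]//|/borderM dz]; rewrite dz ltnn in ltzn.
  - split=> [Xz|Sz e]; rewrite /X.
      by have := Xz true; rewrite /X; case: eqP => [_ []|_]; rewrite ?ab1.
    by rewrite eqn_leq ltnz (dimS z Sz); split=> //; apply/eqP; rewrite eqn_leq ltnz dimS.
  (* The two borders of [M] are disjoint, so an element of both [X n false] and [X n true] must come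
     from [S]. *)
  - split=> [Xz|Sz e]; last by rewrite dz; apply/Xn; left.
    have := Xz true; have := Xz false; rewrite dz => /Xn[[]//|b0] /Xn[[]//|b1].
    by case: b0 b1 => ? ? [].
by apply/seteqP; split=> z /supportX.
Qed.

End Support.

(** * Maximal elements of cells and closure under the operations *)

Section MaxCells.
Context (P : omegaHypergraph).
Implicit Types (A B S : set P) (X Y : faceFamily P).
Hypotheses (P_nonempty : non_emptiness P) (P_acyclic : acyclicity P).
Hypotheses (P_relevant : relevance P) (P_segment : segment_axiom P).

(* If z is below y in X and X_{k,-}, X_{k,+} both contain z, then a face
   relation from w to z with w below y would make z move in a cell W through w
   that has the same boundary as X. *)
Lemma max_cell_union n X : is_cell n X -> max_part (cell_union n X) = cell_support X.
Proof.
move=> cX; apply/seteqP; split=> z.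
  move=> [[i [s [lein Xz]]] maxz].
  have dz := cell_dim cX Xz.
  (* A maximal [z] is no face of [X i.+1 false], so this set leaves it in place when moving
     [X i false] to [X i true], and [z] lies in both. *)
  have notface y : X i.+1 false y -> i < n -> forall e, ~ face e y z.
    move=> Xy ltin e yz.
    have eyz : y = z.
      by apply: maxz; [exists i.+1, false|exact: Rel_face yz].
    have := cell_dim cX Xy; rewrite eyz dz => /eqP.
    by rewrite -[X in X == _]addn0 -addn1 eqn_add2l.
  move=> e; rewrite dz; move: lein; rewrite leq_eqVlt => /orP[/eqP ein|ltin].
    by rewrite ein in Xz *; rewrite (cell_topE e cX) -(cell_topE s cX).
  have nofaces e' : ~ faces e' (X i.+1 false) z.
    by move=> [y Xy]; apply: notface.
  have := nofaces true; have := nofaces false.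
  have := cell_moves false cX ltin z.
  by case: e; case: s Xz; tauto.
move=> Xz; have ledn : dim z <= n.
  by case: leqP => // ltn; have := Xz true; rewrite (cell_above _ cX).
split; first by exists (dim z), true; split=> //; apply: Xz.
move=> y [l [s [leln Xy]]] yz; have [//|neyz] := pselect (y = z).
have [w [e [yw wz]]] := Rel_last yz neyz.
have [W [cW Ww _ lowW]] := cell_through P_nonempty P_acyclic P_relevant P_segment
  cX leln Xy yw.
have dw := face_dim wz; rewrite dw in cW Ww lowW.
have := cell_moves false cW (ltnSn _) z.
have := Xz true; have := Xz false; rewrite -!lowW //.
have : faces e (W (dim z).+1 false) z by exists w.
by case: (e); tauto.
Qed.

Lemma cell_support_fgs n X : is_cell n X -> is_fgs n (cell_support X).
Proof.
move=> cX; have [[finX _ _ _] _ _] := cX; split; last first.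
  move=> z Xz; case: leqP => // ltn.
  by have := Xz true; rewrite (cell_above _ cX).
apply: (@sub_finite_set _ _ (\bigcup_(i in `I_n.+1) X i false)).
  move=> z Xz; exists (dim z); last exact: (Xz false).
  rewrite /= ltnS; case: leqP => // ltn.
  by have := Xz true; rewrite (cell_above _ cX).
by apply: bigcup_finite => // i _.
Qed.

Lemma cell_support_maxwf n X : is_cell n X -> is_maxwf n (cell_support X).
Proof.
have max_support m Y : is_cell m Y -> max_part (cell_support Y) = cell_support Y.
  by move=> cY; rewrite -(max_cell_union cY) max_part_id.
elim: n X => [|n IH] X cX.
  split; [exact: cell_support_fgs|exact: max_support cX| |by []].
  by rewrite (cell_support_top cX); case: cX => _ _; apply.
have cbd e : is_cell n (cell_bd e n X) by apply: cell_bd_cell cX _.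
split; [exact: cell_support_fgs|exact: max_support cX| |split].
- by rewrite (cell_support_top cX); case: cX => _ _; apply.
- by move=> e; rewrite max_bd_support //; apply: IH.
- case: n {IH} X cX cbd => // n X cX cbd e.
  by rewrite !max_bd_support // !cell_bd_bd.
Qed.

Lemma cell_union_dim n X : is_cell n X -> forall x, cell_union n X x -> dim x <= n.
Proof. by move=> cX x [i [e [lein /(cell_dim cX) ->]]]. Qed.

(** Only elements of the common boundary [X i true = Y i false] can be missing from the composite.
    Such an element either already lies in [X i false], resp. [Y i true], or is a face of an element
    of dimension [i.+1], hence is below the composite. *)
Lemma Rclosure_cell_union_comp n i X Y : i < n -> is_cell n X -> is_cell n Y ->
  cell_bd true i X = cell_bd false i Y ->
  Rclosure (cell_union n X) `|` Rclosure (cell_union n Y) =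
  Rclosure (cell_union n (cell_comp n i X Y)).
Proof.
move=> ltin cX cY /cell_bdP[lowXY topXY]; rewrite -RclosureU.
set Z := cell_comp n i X Y.
have Zlow j e : j < i -> Z j e = X j e by rewrite /Z /cell_comp => ->.
have Zhigh j e : i < j -> Z j e = X j e `|` Y j e.
  by move=> ltij; rewrite /Z /cell_comp ltnNge (ltnW ltij) gtn_eqF.
have Zmid e : Z i e = if e then Y i true else X i false.
  by rewrite /Z /cell_comp ltnn eqxx.
apply/seteqP; split; apply: Rclosure_subset => z; last first.
  move=> [j [e [lejn]]]; have [ltji|ltij|->] := ltngtP j i.
  - by rewrite Zlow // => Xz; apply: subset_Rclosure; left; exists j, e.
  - rewrite Zhigh // => -[Xz|Yz]; apply: subset_Rclosure.
      by left; exists j, e.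
    by right; exists j, e.
  - rewrite Zmid; case: e => z_; apply: subset_Rclosure.
      by right; exists i, true; split=> //; apply: ltnW.
    by left; exists i, false; split=> //; apply: ltnW.
have face_in e : faces e (Z i.+1 false) z -> Rclosure (cell_union n Z) z.
  by move=> [y Zy yz]; exists y; [exists i.+1, false|exact: Rel_face yz].
have lein := ltnW ltin.
case=> -[j [e [lejn z_]]]; have [ltji|ltij|eji] := ltngtP j i.
- by apply: subset_Rclosure; exists j, e; rewrite Zlow.
- by apply: subset_Rclosure; exists j, e; rewrite Zhigh //; split=> //; left.
- rewrite eji in z_; have ZX : X i false z -> Rclosure (cell_union n Z) z.
    by move=> Xz; apply: subset_Rclosure; exists i, false; rewrite Zmid.
  case: e z_ => // /((cell_moves false cX ltin z).2) [[/ZX//|Xz] _].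
  apply: (face_in true); rewrite Zhigh // facesU; by left.
- by apply: subset_Rclosure; exists j, e; rewrite Zlow // lowXY.
- by apply: subset_Rclosure; exists j, e; rewrite Zhigh //; split=> //; right.
- rewrite eji in z_; have ZY : Y i true z -> Rclosure (cell_union n Z) z.
    by move=> Yz; apply: subset_Rclosure; exists i, true; rewrite Zmid.
  case: e z_ => // /((cell_moves false cY ltin z).1) [[/ZY//|Yz] _].
  apply: (face_in false); rewrite Zhigh // facesU; by right.
Qed.

(** A set of bounded dimension and its maximal part have the same closure, so supports can be
    replaced by full unions, for which [Rclosure_cell_union_comp] applies. *)
Lemma cell_support_comp n i X Y : i < n -> is_cell n X -> is_cell n Y ->
  cell_bd true i X = cell_bd false i Y ->
  max_part (Rclosure (cell_support X) `|` Rclosure (cell_support Y)) =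
  cell_support (cell_comp n i X Y).
Proof.
move=> ltin cX cY eqXY.
have cZ := comp_cell P_nonempty P_acyclic P_relevant P_segment ltin cX cY eqXY.
rewrite -!(max_cell_union cX, max_cell_union cY, max_cell_union cZ).
rewrite !(Rclosure_max_part (n := n)); [|exact: cell_union_dim..].
by rewrite (Rclosure_cell_union_comp ltin) // max_part_Rclosure.
Qed.

Lemma cell_closed : closed_ops (cell_ops P) (@is_cell P).
Proof.
have hb : bd_closed (O := cell_ops P) (@is_cell P).
  by move=> e n X cX; apply: cell_bd_cell cX _.
apply: (ClosedOps (closed_bd := hb)) => [n X|n i h u v /cell_composableP c].
  exact: cell_id.
exact: (comp_cell P_nonempty P_acyclic P_relevant P_segment h (svalP u) (svalP v)).
Qed.

Lemma maxwf_composableP n i X Y : i < n -> is_cell n X -> is_cell n Y ->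
  @obd_iter (maxwf_ops P) true i (n - i) (cell_support X) =
  @obd_iter (maxwf_ops P) false i (n - i) (cell_support Y) <->
  cell_bd true i X = cell_bd false i Y.
Proof.
move=> ltin cX cY; have lein := ltnW ltin.
rewrite !maxwf_obd_iter //; split=> [|->//]; apply: (cell_support_inj (n := i)).
  exact: cell_bd_cell cX _.
exact: cell_bd_cell cY _.
Qed.

(** Every maximal-well-formed set is the support of a cell, so closure under identities and
    composition is inherited from cells. *)
Lemma maxwf_closed : closed_ops (maxwf_ops P) (@is_maxwf P).
Proof.
have hb : bd_closed (O := maxwf_ops P) (@is_maxwf P).
  by move=> e n X; apply: maxwf_bd.
apply: (ClosedOps (closed_bd := hb)) => [n S|n i h [S wfS] [T wfT]].
  by case/maxwf_support => X cX <-; apply: cell_support_maxwf; apply: cell_id.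
move=> /composableP /=.
have [X cX <-] := maxwf_support wfS; have [Y cY <-] := maxwf_support wfT.
move=> /(maxwf_composableP h cX cY) eqXY.
rewrite (cell_support_comp h) //; apply: cell_support_maxwf.
exact: comp_cell.
Qed.

End MaxCells.

(** * The isomorphism and the transported structure *)

Theorem mainTheorem5 (P : omegaHypergraph)
    (P_nonempty : non_emptiness P) (P_acyclic : acyclicity P)
    (P_relevant : relevance P) (P_segment : segment_axiom P) :
  exists (hC : closed_ops (cell_ops P) (@is_cell P))
         (hM : closed_ops (maxwf_ops P) (@is_maxwf P)),
    strict_omega_cat (Cell hC) /\
    strict_omega_cat (MaxWF hM) /\
    exists F : forall n, Cell hC n -> MaxWF hM n,
      omega_iso F /\
      forall n (X : Cell hC n),
        sval (F n X) = max_part (cell_union n (sval X)).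
Proof.
pose hC := cell_closed P_nonempty P_acyclic P_relevant P_segment.
pose hM := maxwf_closed P_nonempty P_acyclic P_relevant P_segment.
have maxE n (X : faceFamily P) : is_cell n X -> max_part (cell_union n X) = cell_support X.
  exact: max_cell_union.
have wfF n (X : Cell hC n) : is_maxwf n (max_part (cell_union n (sval X))).
  by rewrite (maxE _ _ (svalP X)); apply: cell_support_maxwf (svalP X).
pose F n (X : Cell hC n) : MaxWF hM n := exist (is_maxwf n) _ (wfF n X).
have FE n (X : Cell hC n) : sval (F n X) = cell_support (sval X).
  exact: (maxE _ _ (svalP X)).
have Fsurj n (S : MaxWF hM n) : exists X : Cell hC n, F n X = S.
  have [X cX eqS] := maxwf_support (svalP S).
  by exists (exist _ X cX : Cell hC n); apply: sval_eq; rewrite FE.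
(* The inverse is a choice of preimages; it is also a left inverse because supports determine cells,
   and its functoriality is then formal. *)
pose G n (S : MaxWF hM n) : Cell hC n := sval (cid (Fsurj n S)).
have GK n : cancel (G n) (F n) by move=> S; rewrite /G; case: cid.
have Finj n : injective (F n).
  move=> X Y /(congr1 sval); rewrite !FE => eqXY; apply: sval_eq.
  exact: cell_support_inj (svalP X) (svalP Y) eqXY.
have FK n : cancel (F n) (G n) by move=> X; apply: (Finj n); rewrite GK.
have functorF : omega_functor F.
  split=> [n e u|n u|n i h u v c].
  - apply: sval_eq; rewrite FE /= (maxE _ _ (svalP u)) max_bd_support //.
    exact: (svalP u).
  - by apply: sval_eq; rewrite /= (maxE _ _ (svalP u)) (maxE _ _ (cell_id (svalP u))).
  - have /cell_composableP c0 := c.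
    have c' : composable h (F n u) (F n v).
      apply/composableP; rewrite !FE.
      exact/(maxwf_composableP h (svalP u) (svalP v)).
    exists c'; apply: sval_eq; rewrite [RHS]/= FE.
    rewrite (maxE _ _ (svalP u)) (maxE _ _ (svalP v)).
    by rewrite (cell_support_comp P_nonempty P_acyclic P_relevant P_segment h (svalP u) (svalP v)).
have catC := cell_omega_cat hC.
exists hC, hM; split=> //; split; first exact: transport_omega_cat functorF FK GK catC.
exists F; split=> //; split=> //; exists G; split=> //.
exact: inverse_functor functorF FK GK.
Qed.
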